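(* For any positive integer $n\geq3$, the exponential map $\varepsilon_{D_{2n}}:B(D_{2n})\to B^\times(D_{2n})$ is surjective if and only if $\phi(n)\equiv2\ (\mathrm{mod}\ 4)$, where $\phi$ is Euler's $\phi$-function and $D_{2n}$ is the dihedral group of order $2n$.
   Context: For a finite group $G$, $B(G)$ is the Burnside ring; for $a\in B(G)$, $H\leq G$, $|a^H|\in\mathbb{Z}$ is the image of $a$ under the ring homomorphism induced by $[X]\mapsto|X^H|$; $a$ is determined by $(|a^H|)_{H\leq G}$. $B^\times(G)$ is the unit group of $B(G)$ (an elementary abelian $2$-group). For $H\leq G$, tensor induction $\mathrm{Ten}_H^G:B^\times(H)\to B^\times(G)$ is given by $|\mathrm{Ten}_H^G(a)^L|=\prod_{x\in[L\backslash G/H]}|a^{x^{-1}Lx\cap H}|$ for $L\leq G$. The exponential map $\varepsilon_G:B(G)\to B^\times(G)$ is the group homomorphism (from the additive group of $B(G)$) induced by $[G/H]\mapsto\mathrm{Ten}_H^G(-1)$ for $H\leq G$. *)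

(* Defs.v *)
From HB Require Import structures.
From mathcomp Require Import all_boot all_order all_fingroup all_algebra all_solvable.
From mathcomp Require Import generic_quotient.
From mathcomp Require Import boolp.
From mathcomp Require Import ring zify.

Set Implicit Arguments.
Unset Strict Implicit.
Unset Printing Implicit Defensive.

Import GRing.Theory.
Local Open Scope quotient_scope.
Local Open Scope group_scope.
Local Open Scope ring_scope.

(* Actions are MathComp's right actions: a left G-set X is the right G-set
   x . g = g^-1 x, with the same orbits, stabilisers and fixed points. *)

Section ActionConstructions.

Variables (gT : finGroupType) (G : {group gT}).

Section Transport.
Variables (T : finType) (to : action G T).

Definition ord_act (i : 'I_#|T|) (a : gT) := enum_rank (to (enum_val i) a).

Lemma ord_act_is_action : is_action G ord_act.
Proof.
split=> [a i j|i a b Ga Gb]; rewrite /ord_act ?enum_rankK ?actMin //.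
by move/enum_rank_inj/act_inj/enum_val_inj.
Qed.

Definition ord_action : action G 'I_#|T| := Action ord_act_is_action.
End Transport.

Section SumProd.
Variables (T1 T2 : finType) (to1 : action G T1) (to2 : action G T2).

Definition sum_act (u : T1 + T2) (a : gT) : T1 + T2 :=
  match u with inl x => inl (to1 x a) | inr y => inr (to2 y a) end.

Lemma sum_act_is_action : is_action G sum_act.
Proof.
split=> [a [x|x] [y|y] //= [/act_inj->] //|[x|x] a b Ga Gb /=];
  by rewrite actMin.
Qed.

Definition sum_action : action G (T1 + T2)%type := Action sum_act_is_action.

Definition prod_act (u : T1 * T2) (a : gT) : T1 * T2 :=
  (to1 u.1 a, to2 u.2 a).

Lemma prod_act_is_action : is_action G prod_act.
Proof.
split=> [a [x1 x2] [y1 y2] [/= /act_inj-> /act_inj->] //|[x y] a b Ga Gb].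
by rewrite /prod_act /= !actMin.
Qed.

Definition prod_action : action G (T1 * T2)%type := Action prod_act_is_action.
End SumProd.

Section Trivial.
Variable T : finType.

Lemma triv_act_is_action : is_action G (fun (x : T) (_ : gT) => x).
Proof. by split=> [a x y|]. Qed.

Definition triv_action : action G T := Action triv_act_is_action.
End Trivial.

Section Coset.
Variable H : {group gT}.

Lemma rcosets_stable :
  G \subset subact_dom (fun A : {set gT} => A \in rcosets H G) 'Rs.
Proof.
rewrite /subact_dom (_ : [set A | _] = rcosets H G) ?actsRs_rcosets //.
by apply/setP=> A; rewrite inE.
Qed.

(* The transitive G-set H\G of right cosets: the left G-set G/H. *)
Definition coset_action :
    action G {A : {set gT} | A \in rcosets H G} :=
  ('Rs^? \ rcosets_stable)%act.
End Coset.

Definition act_iso (T T' : finType) (to : action G T) (to' : action G T') :=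
  exists2 f : T -> T', bijective f &
    forall x a, a \in G -> f (to x a) = to' (f x) a.

End ActionConstructions.

Section ActionIsomorphism.

Variables (gT : finGroupType) (G : {group gT}).
Implicit Types T : finType.

Lemma act_iso_refl T (to : action G T) : act_iso to to.
Proof. by exists id => //; exists id. Qed.

Lemma act_iso_sym T T' (to : action G T) (to' : action G T') :
  act_iso to to' -> act_iso to' to.
Proof.
case=> f [g gK fK] fE; exists g => [|x a Ga]; first by exists f.
by apply: (can_inj gK); rewrite fE // !fK.
Qed.

Lemma act_iso_trans T T' T'' (to : action G T) (to' : action G T')
    (to'' : action G T'') :
  act_iso to to' -> act_iso to' to'' -> act_iso to to''.
Proof.
move=> [f f_bij fE] [g g_bij gE]; exists (g \o f) => [|x a Ga /=].
  exact: bij_comp.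
by rewrite fE ?gE.
Qed.

Lemma act_iso_ord T (to : action G T) : act_iso to (ord_action to).
Proof.
exists (@enum_rank T) => [|x a Ga]; last by rewrite /= /ord_act enum_rankK.
by exists enum_val; [apply: enum_rankK | apply: enum_valK].
Qed.

Lemma act_iso_sum T1 T1' T2 T2' (to1 : action G T1) (to1' : action G T1')
    (to2 : action G T2) (to2' : action G T2') :
  act_iso to1 to1' -> act_iso to2 to2' ->
  act_iso (sum_action to1 to2) (sum_action to1' to2').
Proof.
move=> [f1 [g1 f1K g1K] f1E] [f2 [g2 f2K g2K] f2E].
exists (fun u => match u with inl x => inl (f1 x) | inr y => inr (f2 y) end).
  exists (fun u => match u with inl x => inl (g1 x) | inr y => inr (g2 y) end).
    by case=> x; rewrite ?f1K ?f2K.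
  by case=> x; rewrite ?g1K ?g2K.
by case=> x a Ga /=; rewrite ?f1E ?f2E.
Qed.

Lemma act_iso_prod T1 T1' T2 T2' (to1 : action G T1) (to1' : action G T1')
    (to2 : action G T2) (to2' : action G T2') :
  act_iso to1 to1' -> act_iso to2 to2' ->
  act_iso (prod_action to1 to2) (prod_action to1' to2').
Proof.
move=> [f1 [g1 f1K g1K] f1E] [f2 [g2 f2K g2K] f2E].
exists (fun u => (f1 u.1, f2 u.2)).
  by exists (fun u => (g1 u.1, g2 u.2)); case=> x y;
     rewrite ?f1K ?f2K ?g1K ?g2K.
by case=> x y a Ga /=; rewrite /prod_act /= f1E ?f2E.
Qed.

End ActionIsomorphism.

(* Up to isomorphism a finite G-set has carrier 'I_n; fixing such carriers keeps
   the collection of finite G-sets in a small type. *)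
Record gset (gT : finGroupType) (G : {group gT}) :=
  GSet { gset_card : nat; gset_act : action G 'I_gset_card }.

HB.instance Definition _ gT (G : {group gT}) := gen_eqMixin (gset G).
HB.instance Definition _ gT (G : {group gT}) := gen_choiceMixin (gset G).

Section IsomorphismClasses.

Variables (gT : finGroupType) (G : {group gT}).

Definition gset_iso (X Y : gset G) : bool :=
  `[< act_iso (gset_act X) (gset_act Y) >].

Lemma gset_iso_is_equiv : equiv_class_of gset_iso.
Proof.
split=> [X|X Y|Y X Z].
- exact/asboolP/act_iso_refl.
- by apply/asboolP/asboolP; apply: act_iso_sym.
- by move=> /asboolP XY /asboolP YZ; apply/asboolP/(act_iso_trans XY YZ).
Qed.

Canonical gset_iso_equiv := EquivRelPack gset_iso_is_equiv.

Definition gclass := {eq_quot gset_iso}.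

HB.instance Definition _ := Choice.on gclass.
HB.instance Definition _ := EqQuotient.on gclass.

Definition cls (T : finType) (to : action G T) : gclass :=
  \pi_gclass (GSet (ord_action to)).

Definition gclass_act (x : gclass) := gset_act (repr x).

Lemma clsP (T T' : finType) (to : action G T) (to' : action G T') :
  cls to = cls to' <-> act_iso to to'.
Proof.
split=> [/eqmodP/asboolP /= iso_o | iso].
  apply: act_iso_trans (act_iso_ord to) _.
  exact: act_iso_trans iso_o (act_iso_sym (act_iso_ord to')).
apply/eqmodP/asboolP => /=.
apply: act_iso_trans (act_iso_sym (act_iso_ord to)) _.
exact: act_iso_trans iso (act_iso_ord to').
Qed.

Lemma gclass_actK (x : gclass) : cls (gclass_act x) = x.
Proof.
rewrite -[RHS]reprK; apply/eqmodP/asboolP => /=.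
exact/act_iso_sym/act_iso_ord.
Qed.

Lemma act_iso_repr (T : finType) (to : action G T) :
  act_iso (gclass_act (cls to)) to.
Proof. by apply/clsP; rewrite gclass_actK. Qed.

Definition gclass_add (x y : gclass) :=
  cls (sum_action (gclass_act x) (gclass_act y)).
Definition gclass_mul (x y : gclass) :=
  cls (prod_action (gclass_act x) (gclass_act y)).
Definition gclass_zero := cls (triv_action G void).
Definition gclass_one := cls (triv_action G unit).

Lemma cls_add (T T' : finType) (to : action G T) (to' : action G T') :
  gclass_add (cls to) (cls to') = cls (sum_action to to').
Proof. by apply/clsP/act_iso_sum; apply: act_iso_repr. Qed.

Lemma cls_mul (T T' : finType) (to : action G T) (to' : action G T') :
  gclass_mul (cls to) (cls to') = cls (prod_action to to').
Proof. by apply/clsP/act_iso_prod; apply: act_iso_repr. Qed.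

Lemma gclass_addA : associative gclass_add.
Proof.
move=> x y z; rewrite -[x]gclass_actK -[y]gclass_actK -[z]gclass_actK !cls_add.
apply/clsP; exists (fun u => match u with
  | inl a => inl (inl a) | inr (inl b) => inl (inr b)
  | inr (inr c) => inr c end); last by case=> [?|[?|?]].
by exists (fun u => match u with
  | inl (inl a) => inl a | inl (inr b) => inr (inl b)
  | inr c => inr (inr c) end) => [[?|[?|?]]|[[?|?]|?]].
Qed.

Lemma gclass_addC : commutative gclass_add.
Proof.
move=> x y; rewrite -[x]gclass_actK -[y]gclass_actK !cls_add.
apply/clsP; exists (fun u => match u with
  | inl a => inr a | inr b => inl b end); last by case.
by exists (fun u => match u with inl a => inr a | inr b => inl b end); case.
Qed.

Lemma gclass_add0 : left_id gclass_zero gclass_add.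
Proof.
move=> x; rewrite -[x]gclass_actK cls_add.
apply/clsP; exists (fun u => match u with
  | inl v => of_void _ v | inr b => b end); last by case.
by exists inr => //; case.
Qed.

HB.instance Definition _ := GRing.isNmodule.Build gclass
  gclass_addA gclass_addC gclass_add0.

Lemma gclass_mulA : associative gclass_mul.
Proof.
move=> x y z; rewrite -[x]gclass_actK -[y]gclass_actK -[z]gclass_actK !cls_mul.
apply/clsP; exists (fun u => (u.1, u.2.1, u.2.2)); last by [].
by exists (fun u => (u.1.1, (u.1.2, u.2))) => [[? [? ?]]|[[? ?] ?]].
Qed.

Lemma gclass_mulC : commutative gclass_mul.
Proof.
move=> x y; rewrite -[x]gclass_actK -[y]gclass_actK !cls_mul.
apply/clsP; exists (fun u => (u.2, u.1)); last by [].
by exists (fun u => (u.2, u.1)); case.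
Qed.

Lemma gclass_mul1 : left_id gclass_one gclass_mul.
Proof.
move=> x; rewrite -[x]gclass_actK cls_mul.
apply/clsP; exists snd; last by [].
by exists (fun u => (tt, u)) => //; case; case.
Qed.

Lemma gclass_mulDl : left_distributive gclass_mul gclass_add.
Proof.
move=> x y z; rewrite -[x]gclass_actK -[y]gclass_actK -[z]gclass_actK.
rewrite !(cls_add, cls_mul).
apply/clsP; exists (fun u => match u with
  | (inl a, c) => inl (a, c) | (inr b, c) => inr (b, c) end); last first.
  by case=> [[?|?] ?].
by exists (fun u => match u with
  | inl (a, c) => (inl a, c) | inr (b, c) => (inr b, c) end)
  => [[[?|?] ?]|[[? ?]|[? ?]]].
Qed.

Lemma gclass_mul0 : left_zero gclass_zero gclass_mul.
Proof.
move=> x; rewrite -[x]gclass_actK cls_mul.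
by apply/clsP; exists fst => [|[]//]; exists (of_void _); case.
Qed.

Lemma gclass_one_neq0 : gclass_one != gclass_zero.
Proof. by apply/eqP=> /clsP[f _ _]; case: (f tt). Qed.

HB.instance Definition _ := GRing.Nmodule_isComNzSemiRing.Build gclass
  gclass_mulA gclass_mulC gclass_mul1 gclass_mulDl gclass_mul0 gclass_one_neq0.

Lemma clsD (T T' : finType) (to : action G T) (to' : action G T') :
  cls to + cls to' = cls (sum_action to to').
Proof. exact: cls_add. Qed.

Lemma clsM (T T' : finType) (to : action G T) (to' : action G T') :
  cls to * cls to' = cls (prod_action to to').
Proof. exact: cls_mul. Qed.

End IsomorphismClasses.

Section FixedPoints.

Variables (gT : finGroupType) (G : {group gT}).
Implicit Type L : {set gT}.

Definition gmark L (x : gclass G) : nat := #|'Fix_(gclass_act x)(L)|.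

Lemma afixE (T : finType) (to : action G T) L :
  'Fix_to(L) = [set x | [forall a in L, to x a == x]].
Proof.
apply/setP=> x; rewrite !inE; apply/subsetP/forall_inP => fix_x a /fix_x.
  by rewrite inE.
by rewrite inE.
Qed.

Lemma card_afix_iso (T T' : finType) (to : action G T) (to' : action G T') L :
  L \subset G -> act_iso to to' -> #|'Fix_to(L)| = #|'Fix_to'(L)|.
Proof.
move=> sLG [f f_bij fE]; rewrite -(card_imset _ (bij_inj f_bij)).
apply: eq_card => y; have [g gK fK] := f_bij.
rewrite -[y]fK (mem_imset _ _ (bij_inj f_bij)) !afixE !inE.
apply: eq_forallb_in => a La.
by rewrite -fE ?(subsetP sLG) // (inj_eq (bij_inj f_bij)).
Qed.

Lemma gmark_cls L (T : finType) (to : action G T) :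
  L \subset G -> gmark L (cls to) = #|'Fix_to(L)|.
Proof. by move=> sLG; apply: card_afix_iso (act_iso_repr to). Qed.

Lemma gmark0 L : L \subset G -> gmark L 0 = 0%N.
Proof.
by move=> sLG; rewrite gmark_cls //; apply: eq_card0 => -[].
Qed.

Lemma gmark1 L : L \subset G -> gmark L 1 = 1%N.
Proof.
move=> sLG; rewrite gmark_cls // -card_unit; apply: eq_card => x.
by rewrite afixE !inE; apply/forall_inP => a _.
Qed.

Lemma gmarkD L : L \subset G -> {morph gmark L : x y / x + y >-> (x + y)%N}.
Proof.
move=> sLG x y; rewrite -[x]gclass_actK -[y]gclass_actK clsD !gmark_cls //.
rewrite -!sum1_card big_sumType; congr (_ + _)%N; apply: eq_bigl => z;
  rewrite !afixE !inE; apply: eq_forallb_in => a _ /=.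
  by rewrite (inj_eq inl_inj).
by rewrite (inj_eq inr_inj).
Qed.

Lemma gmarkM L : L \subset G -> {morph gmark L : x y / x * y >-> (x * y)%N}.
Proof.
move=> sLG x y; rewrite -[x]gclass_actK -[y]gclass_actK clsM !gmark_cls //.
rewrite -cardsX; apply: eq_card => -[u v]; rewrite in_setX !afixE !inE /=.
apply/forall_inP/andP=> [fix_uv|[/forall_inP fix_u /forall_inP fix_v] a La].
  by split; apply/forall_inP=> a /fix_uv /eqP[eu ev]; apply/eqP.
by rewrite /prod_action /= /prod_act /= (eqP (fix_u a La)) (eqP (fix_v a La)).
Qed.

End FixedPoints.

Section BurnsideRing.

Variables (gT : finGroupType) (G : {group gT}).
Implicit Types (u v : gclass G * gclass G) (x y z : gclass G).

Definition diff_equiv u v : bool :=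
  `[< exists z, u.1 + v.2 + z = v.1 + u.2 + z >].

Lemma diff_equiv_is_equiv : equiv_class_of diff_equiv.
Proof.
split=> [u|u v|v u w].
- by apply/asboolP; exists 0.
- by apply/asboolP/asboolP=> -[z uv]; exists z.
move=> /asboolP[z uv] /asboolP[z' vw]; apply/asboolP.
exists (v.1 + v.2 + z + z').
transitivity ((u.1 + v.2 + z) + (v.1 + w.2 + z')); first by ring.
by rewrite uv vw; ring.
Qed.

Canonical diff_equiv_rel := EquivRelPack diff_equiv_is_equiv.

(* The Grothendieck ring of the semiring of isomorphism classes of finite
   G-sets. *)
Definition burnside := {eq_quot diff_equiv}.

HB.instance Definition _ := Choice.on burnside.
HB.instance Definition _ := EqQuotient.on burnside.

Definition gdiff x y : burnside := \pi_burnside (x, y).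

Definition gset_class (T : finType) (to : action G T) : burnside :=
  gdiff (cls to) 0.

Lemma gdiffP x y x' y' :
  gdiff x y = gdiff x' y' <-> exists z, x + y' + z = x' + y + z.
Proof.
by split=> [/eqmodP/asboolP // | xy]; apply/eqmodP/asboolP.
Qed.

Lemma gdiff_repr (a : burnside) : gdiff (repr a).1 (repr a).2 = a.
Proof. by rewrite /gdiff -surjective_pairing reprK. Qed.

Lemma repr_gdiff x y :
  exists z, (repr (gdiff x y)).1 + y + z = x + (repr (gdiff x y)).2 + z.
Proof. by apply/gdiffP; rewrite gdiff_repr. Qed.

Definition burnside_add (a b : burnside) : burnside :=
  gdiff ((repr a).1 + (repr b).1) ((repr a).2 + (repr b).2).
Definition burnside_opp (a : burnside) : burnside :=
  gdiff (repr a).2 (repr a).1.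
Definition burnside_mul (a b : burnside) : burnside :=
  gdiff ((repr a).1 * (repr b).1 + (repr a).2 * (repr b).2)
        ((repr a).1 * (repr b).2 + (repr a).2 * (repr b).1).

Lemma gdiff_add x y x' y' :
  burnside_add (gdiff x y) (gdiff x' y') = gdiff (x + x') (y + y').
Proof.
apply/gdiffP; have [z xy] := repr_gdiff x y; have [z' xy'] := repr_gdiff x' y'.
move: (repr (gdiff x y)) (repr (gdiff x' y')) xy xy' => u v uE vE.
exists (z + z'); transitivity ((u.1 + y + z) + (v.1 + y' + z')); first by ring.
by rewrite uE vE; ring.
Qed.

Lemma gdiff_opp x y : burnside_opp (gdiff x y) = gdiff y x.
Proof.
apply/gdiffP; have [z] := repr_gdiff x y; move: (repr _) => u uE; exists z.
transitivity (x + u.2 + z); first by ring.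
by rewrite -uE; ring.
Qed.

Lemma gdiff_mul x y x' y' :
  burnside_mul (gdiff x y) (gdiff x' y') =
  gdiff (x * x' + y * y') (x * y' + y * x').
Proof.
apply/gdiffP; have [z xy] := repr_gdiff x y; have [z' xy'] := repr_gdiff x' y'.
move: (repr (gdiff x y)) (repr (gdiff x' y')) xy xy' => u v uE vE.
exists (x * v.2 + y * v.1 + z * (v.1 + v.2) + z' * (x + y) + x * v.1 + y * v.2).
have swap_u : (u.1 + y + z) * v.1 + (x + u.2 + z) * v.2 =
  (x + u.2 + z) * v.1 + (u.1 + y + z) * v.2 by rewrite uE.
have swap_v : x * (v.1 + y' + z') + y * (x' + v.2 + z') =
  x * (x' + v.2 + z') + y * (v.1 + y' + z') by rewrite vE.
transitivity ((u.1 + y + z) * v.1 + (x + u.2 + z) * v.2 +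
  (x * (v.1 + y' + z') + y * (x' + v.2 + z'))); first by ring.
by rewrite swap_u swap_v; ring.
Qed.

Let gdiffE := (gdiff_add, gdiff_opp, gdiff_mul).

Lemma burnside_addA : associative burnside_add.
Proof.
move=> a b c; rewrite -[a]gdiff_repr -[b]gdiff_repr -[c]gdiff_repr !gdiffE.
by rewrite !addrA.
Qed.

Lemma burnside_addC : commutative burnside_add.
Proof.
move=> a b; rewrite -[a]gdiff_repr -[b]gdiff_repr !gdiffE.
by congr gdiff; rewrite addrC.
Qed.

Lemma burnside_add0 : left_id (gdiff 0 0) burnside_add.
Proof. by move=> a; rewrite -[a]gdiff_repr !gdiffE !add0r. Qed.

Lemma burnside_addN : left_inverse (gdiff 0 0) burnside_opp burnside_add.
Proof.
move=> a; rewrite -[a]gdiff_repr !gdiffE; apply/gdiffP.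
by exists 0; rewrite !addr0 add0r addrC.
Qed.

HB.instance Definition _ := GRing.isZmodule.Build burnside
  burnside_addA burnside_addC burnside_add0 burnside_addN.

Lemma burnside_mulA : associative burnside_mul.
Proof.
move=> a b c; rewrite -[a]gdiff_repr -[b]gdiff_repr -[c]gdiff_repr !gdiffE.
by congr gdiff; ring.
Qed.

Lemma burnside_mulC : commutative burnside_mul.
Proof.
move=> a b; rewrite -[a]gdiff_repr -[b]gdiff_repr !gdiffE.
by congr gdiff; ring.
Qed.

Lemma burnside_mul1 : left_id (gdiff 1 0) burnside_mul.
Proof.
move=> a; rewrite -[a]gdiff_repr !gdiffE.
by rewrite !mul1r !mul0r !addr0.
Qed.

Lemma burnside_mulDl : left_distributive burnside_mul burnside_add.
Proof.
move=> a b c; rewrite -[a]gdiff_repr -[b]gdiff_repr -[c]gdiff_repr !gdiffE.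
by congr gdiff; ring.
Qed.

Lemma burnside_one_neq0 : gdiff 1 0 != gdiff 0 0.
Proof.
apply/eqP=> /gdiffP[z /(congr1 (gmark [1 gT]))]; rewrite !gmarkD ?sub1G //.
by rewrite gmark0 ?gmark1 ?sub1G // !addn0 !add0n -[RHS]add0n => /addIn.
Qed.

HB.instance Definition _ := GRing.Zmodule_isComNzRing.Build burnside
  burnside_mulA burnside_mulC burnside_mul1 burnside_mulDl burnside_one_neq0.

Definition burnside_unit : {pred burnside} :=
  fun a => `[< exists b : burnside, b * a = 1 >].
Definition burnside_inv (a : burnside) : burnside :=
  if pselect (exists b : burnside, b * a = 1) is left ex
  then projT1 (cid ex) else a.

Lemma burnside_mulV : {in burnside_unit, left_inverse 1 burnside_inv *%R}.
Proof.
move=> a /asboolP Ua; rewrite /burnside_inv; case: pselect => // ex.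
by case: cid.
Qed.

Lemma burnside_unitPl (a b : burnside) : b * a = 1 -> burnside_unit a.
Proof. by move=> ba1; apply/asboolP; exists b. Qed.

Lemma burnside_inv_out : {in [predC burnside_unit], burnside_inv =1 id}.
Proof.
move=> a Ua; rewrite /burnside_inv; case: pselect => // ex.
by case/negP: Ua; apply/asboolP.
Qed.

HB.instance Definition _ := GRing.ComNzRing_hasMulInverse.Build burnside
  burnside_mulV burnside_unitPl burnside_inv_out.

Lemma gdiffD x y x' y' : gdiff x y + gdiff x' y' = gdiff (x + x') (y + y').
Proof. exact: gdiff_add. Qed.

Lemma gdiffN x y : - gdiff x y = gdiff y x.
Proof. exact: gdiff_opp. Qed.

Lemma gdiffM x y x' y' :
  gdiff x y * gdiff x' y' = gdiff (x * x' + y * y') (x * y' + y * x').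
Proof. exact: gdiff_mul. Qed.

Lemma gset_classD (T T' : finType) (to : action G T) (to' : action G T') :
  gset_class (sum_action to to') = gset_class to + gset_class to'.
Proof. by rewrite gdiffD clsD addr0. Qed.

Lemma gset_classM (T T' : finType) (to : action G T) (to' : action G T') :
  gset_class (prod_action to to') = gset_class to * gset_class to'.
Proof. by rewrite gdiffM clsM !mulr0 !mul0r !addr0. Qed.

(* Fixed points of L; a ring homomorphism to int when L is contained in G. *)
Definition mark (L : {set gT}) (a : burnside) : int :=
  (gmark L (repr a).1)%:Z - (gmark L (repr a).2)%:Z.

Section Marks.
Variable L : {set gT}.
Hypothesis sLG : L \subset G.

Lemma mark_gdiff x y : mark L (gdiff x y) = (gmark L x)%:Z - (gmark L y)%:Z.
Proof.
have [z] := repr_gdiff x y; rewrite /mark; move: (repr _) => u.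
move/(congr1 (fun w => (gmark L w)%:Z)); rewrite !gmarkD // !PoszD => /addIr uE.
by apply/eqP; rewrite subr_eq addrAC -uE addrK.
Qed.

Lemma mark_gset_class (T : finType) (to : action G T) :
  mark L (gset_class to) = #|'Fix_to(L)|%:Z.
Proof. by rewrite mark_gdiff gmark0 // gmark_cls // subr0. Qed.

Lemma markD : {morph mark L : a b / a + b}.
Proof.
move=> a b; rewrite -[a]gdiff_repr -[b]gdiff_repr gdiffD !mark_gdiff !gmarkD //.
by rewrite !PoszD; ring.
Qed.

Lemma markN : {morph mark L : a / - a}.
Proof.
by move=> a; rewrite -[a]gdiff_repr gdiffN !mark_gdiff opprB.
Qed.

Lemma markM : {morph mark L : a b / a * b}.
Proof.
move=> a b; rewrite -[a]gdiff_repr -[b]gdiff_repr gdiffM !mark_gdiff.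
rewrite !gmarkD // !gmarkM //.
by rewrite !PoszD !PoszM; ring.
Qed.

Lemma mark1 : mark L 1 = 1.
Proof. by rewrite mark_gdiff gmark0 // gmark1. Qed.
End Marks.

End BurnsideRing.

Section Restriction.

Variables (gT : finGroupType) (G : {group gT}) (T : finType).
Variables (to : action G T) (S : {set T}) (nSG : [acts G, on S | to]).

Lemma restr_stable : G \subset subact_dom (fun x => x \in S) to.
Proof.
rewrite /subact_dom (_ : [set x | _] = S) //.
by apply/setP=> x; rewrite inE.
Qed.

Definition restr_action : action G {x | x \in S} := (to^? \ restr_stable)%act.

Lemma val_restr_action (x : {x | x \in S}) a :
  a \in G -> val (restr_action x a) = to (val x) a.
Proof.
by move=> Ga; rewrite /restr_action /= val_subact (subsetP restr_stable).
Qed.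

End Restriction.

Section MarksDetermine.

Variables (gT : finGroupType) (G : {group gT}).

Lemma val_coset_action (H : {group gT}) (A : {A | A \in rcosets H G}) a :
  a \in G -> val (coset_action G H A a) = (val A :* a)%g.
Proof.
by move=> Ga; rewrite /= val_subact (subsetP (rcosets_stable G H)) //= rcosetE.
Qed.

Lemma in_stab (T : finType) (to : action G T) (t : T) a :
  (a \in 'C_G[t | to]) = (a \in G) && (to t a == t).
Proof. by rewrite !inE sub1set inE; case: (a \in G). Qed.

Lemma cls_split (T : finType) (to : action G T) (x : T)
    (nOG : [acts G, on ~: orbit to G x | to]) :
  cls to = cls (coset_action G 'C_G[x | to]) + cls (restr_action nOG).
Proof.
set H := 'C_G[x | to]%G.
pose f (u : {A | A \in rcosets H G} + {y | y \in ~: orbit to G x}) :=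
  match u with inl A => to x (fingroup.repr (val A)) | inr y => val y end.
have fE a : a \in G -> to x (fingroup.repr (H :* a)%g) = to x a.
  move=> Ga; have [h Hh ->] : exists2 h, h \in H & fingroup.repr (H :* a)%g = (h * a)%g.
    by have /rcosetP[h Hh ->] := mem_repr_rcoset H a; exists h.
  move: Hh; rewrite /= in_stab => /andP[Gh /eqP fx].
  by rewrite actMin ?fx.
have xG A : A \in rcosets H G -> exists2 a, a \in G & A = (H :* a)%g.
  by case/rcosetsP=> a Ga ->; exists a.
rewrite clsD; apply/esym/clsP; exists f; last first.
  case=> [[A rA]|y] a Ga /=; last by rewrite val_restr_action.
  have [b Gb eA] := xG _ rA; rewrite val_coset_action //= eA.
  by rewrite -rcosetM !fE ?groupM // actMin.
apply: inj_card_bij.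
  have O_A A : A \in rcosets H G -> to x (fingroup.repr A) \in orbit to G x.
    by case/xG=> a Ga ->; rewrite fE // mem_orbit.
  move=> [[A rA]|[y Oy]] [[B rB]|[z Oz]] /= e.
  - congr inl; apply: val_inj => /=.
    have [a Ga eA] := xG _ rA; have [b Gb eB] := xG _ rB.
    move: e; rewrite eA eB !fE // => e; apply/rcoset_eqP.
    rewrite mem_rcoset /= in_stab groupM ?groupV //=; apply/eqP.
    by rewrite actMin ?groupV // e actKin.
  - by have /setCP[] := Oz; rewrite -e O_A.
  - by have /setCP[] := Oy; rewrite e O_A.
  - by congr inr; apply: val_inj.
rewrite card_sum !card_sig.
rewrite -(cardC (mem (orbit to G x))) leq_add //.
  by rewrite card_orbit_in.
by apply/subset_leq_card/subsetP=> y; rewrite !inE.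
Qed.

Lemma card_afix1 (T : finType) (to : action G T) : #|'Fix_to([1 gT])| = #|T|.
Proof.
rewrite -cardsT; apply: eq_card => u; rewrite afixE !inE.
by apply/forall_inP=> a /set1P->; rewrite (act1 to).
Qed.

Lemma sub_stab (T : finType) (to : action G T) (t : T) (K : {group gT}) :
  K \subset G -> (t \in 'Fix_to(K)) = (K \subset 'C_G[t | to]).
Proof.
move=> sKG; rewrite afixE inE; apply/forall_inP/subsetP=> fixK a Ka.
  by rewrite in_stab (subsetP sKG) //= fixK.
by have := fixK a Ka; rewrite in_stab => /andP[].
Qed.

Lemma stab_inl (T T' : finType) (to : action G T) (to' : action G T') t :
  'C_G[inl t | sum_action to to'] = 'C_G[t | to].
Proof.
apply/setP=> a; rewrite !in_stab /=.
by rewrite (inj_eq inl_inj).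
Qed.

Lemma stab_inr (T T' : finType) (to : action G T) (to' : action G T') t :
  'C_G[inr t | sum_action to to'] = 'C_G[t | to'].
Proof.
apply/setP=> a; rewrite !in_stab /=.
by rewrite (inj_eq inr_inj).
Qed.

Lemma acts_setC_orbit (T : finType) (to : action G T) t :
  [acts G, on ~: orbit to G t | to].
Proof. by rewrite astabsC; apply: acts_orbit. Qed.

Lemma cls_marks_inj n (T T' : finType) (to : action G T) (to' : action G T') :
    (#|T| <= n)%N ->
    (forall L : {group gT}, L \subset G -> #|'Fix_to(L)| = #|'Fix_to'(L)|) ->
  cls to = cls to'.
Proof.
elim: n => [|n IHn] in T T' to to' * => leTn eqF.
  have cardT : #|T| = #|T'|.
    by rewrite -(card_afix1 to) -(card_afix1 to') eqF ?sub1G.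
  have T0 : #|T| = 0%N by apply/eqP; rewrite -leqn0.
  have no_T (t : T) : False by have := fintype0 t T0.
  have no_T' (t' : T') : False by have := fintype0 t' (etrans (esym cardT) T0).
  apply/clsP; exists (fun t => False_rect T' (no_T t)); last first.
    by move=> t; case: (no_T t).
  by exists (fun t' => False_rect T (no_T' t')) => t;
    [case: (no_T t) | case: (no_T' t)].
have [T0 | /card_gt0P[t0 _]] := posnP #|T|.
  by apply: IHn => //; rewrite T0.
have stab_eq t t' : 'C_G[t | to] = 'C_G[t' | to'] -> cls to = cls to'.
  move=> eq_stab; have so := cls_split (acts_setC_orbit to t).
  have so' := cls_split (acts_setC_orbit to' t').
  have eq_stabG : 'C_G[t | to]%G = 'C_G[t' | to']%G by apply: val_inj.
  rewrite so so' eq_stabG; congr (_ + _); apply: IHn => [|L sLG].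
    rewrite card_sig -ltnS; apply: leq_trans leTn.
    rewrite -[in ltnRHS](cardC (mem (orbit to G t))) -add1n leq_add //.
      by apply/card_gt0P; exists t; apply: orbit_refl.
    by apply/subset_leq_card/subsetP=> w; rewrite !inE.
  have := eqF L sLG; rewrite -!gmark_cls // so so' eq_stabG !gmarkD //.
  exact: addnI.
pose st (w : T + T') := #|'C_G[w | sum_action to to']|.
case: (@arg_maxnP _ (inl t0) predT st isT) => -[t|t] _ max_t.
  have : (0 < #|'Fix_to('C_G[t | to])|)%N.
    by apply/card_gt0P; exists t; rewrite sub_stab ?subsetIl.
  rewrite eqF ?subsetIl // => /card_gt0P[t']; rewrite sub_stab ?subsetIl //.
  move=> st_t'; apply: (stab_eq t t'); apply/eqP; rewrite eqEcard st_t'.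
  by have := max_t (inr t') isT; rewrite /st stab_inl stab_inr.
have : (0 < #|'Fix_to'('C_G[t | to'])|)%N.
  by apply/card_gt0P; exists t; rewrite sub_stab ?subsetIl.
rewrite -eqF ?subsetIl // => /card_gt0P[t']; rewrite sub_stab ?subsetIl //.
move=> st_t'; apply: (stab_eq t' t); apply/esym/eqP; rewrite eqEcard st_t'.
by have := max_t (inl t') isT; rewrite /st stab_inl stab_inr.
Qed.

Lemma mark_inj (a b : burnside G) :
  (forall L : {group gT}, L \subset G -> mark L a = mark L b) -> a = b.
Proof.
rewrite -[a]gdiff_repr -[b]gdiff_repr; move: (repr a) (repr b) => u v eq_uv.
apply/gdiffP; exists 0; congr (_ + _).
rewrite -[LHS]gclass_actK -[RHS]gclass_actK.
apply: cls_marks_inj (leqnn _) _ => L sLG.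
change (gmark L (u.1 + v.2) = gmark L (v.1 + u.2)).
have := eq_uv L sLG; rewrite !mark_gdiff // !gmarkD // => /eqP.
by rewrite subr_eq addrAC eq_sym subr_eq -!PoszD => /eqP[->].
Qed.

End MarksDetermine.

Section TensorInduction.

Variables (gT : finGroupType) (G H : {group gT}).
Implicit Types (a : burnside H) (u : burnside G).

(* The factor indexed by a double coset D = L x H does not depend on the choice
   of the representative x; note that L :^ x is x^-1 L x. *)
Definition is_tensor_induction a u : Prop :=
  u \is a GRing.unit /\
  forall L : {group gT}, L \subset G ->
    mark L u = \prod_(D in [set (L :* x * H)%g | x in G])
                  mark ((L :^ fingroup.repr D) :&: H)%g a.

(* By mark_inj such a unit is unique; for a = -1, the only case used below, it
   exists by tensor_inductionN1P, so the default value 1 is not taken. *)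
Definition tensor_induction a : burnside G :=
  if pselect (exists u, is_tensor_induction a u) is left ex
  then projT1 (cid ex) else 1.

Lemma tensor_induction_unit a : tensor_induction a \is a GRing.unit.
Proof.
rewrite /tensor_induction; case: pselect => [ex|_]; last exact: unitr1.
by case: cid => u [].
Qed.

Lemma is_tensor_induction_uniq a u u' :
  is_tensor_induction a u -> is_tensor_induction a u' -> u = u'.
Proof.
by move=> [_ uE] [_ uE']; apply: mark_inj => L sLG; rewrite uE ?uE'.
Qed.

Lemma tensor_inductionE a u : is_tensor_induction a u -> tensor_induction a = u.
Proof.
move=> a_u; rewrite /tensor_induction; case: pselect => [ex|[]]; last by exists u.
by case: cid => v a_v; apply: is_tensor_induction_uniq a_v a_u.
Qed.

Lemma markN1 (L : {set gT}) : L \subset H -> mark L (-1 : burnside H) = -1.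
Proof. by move=> sLH; rewrite markN // mark1. Qed.

Lemma is_tensor_inductionN1 u :
  is_tensor_induction (-1) u <->
  u \is a GRing.unit /\ forall L : {group gT}, L \subset G ->
    mark L u = (-1) ^+ #|[set (L :* x * H)%g | x in G]|.
Proof.
have prodE (L : {group gT}) : \prod_(D in [set (L :* x * H)%g | x in G])
    mark ((L :^ fingroup.repr D) :&: H)%g (-1 : burnside H)
    = (-1) ^+ #|[set (L :* x * H)%g | x in G]|.
  by rewrite -prodr_const; apply: eq_bigr => D _; rewrite markN1 ?subsetIr.
by split=> -[Uu uE]; split=> // L sLG; rewrite uE // prodE.
Qed.

End TensorInduction.

Section TensorInductionOfN1.

Variables (gT : finGroupType) (G : {group gT}).

Lemma tensor_inductionN1_conj (H H' : {group gT}) g :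
  g \in G -> H' :=: (H :^ g)%g ->
  tensor_induction G (-1 : burnside H') = tensor_induction G (-1 : burnside H).
Proof.
move=> Gg defH'.
have cardE (L : {group gT}) :
    #|[set (L :* x * H')%g | x in G]| = #|[set (L :* x * H)%g | x in G]|.
  have shift x : (L :* x * H')%g = ((L :* (x * g^-1)) * H :* g)%g.
    by rewrite defH' conjsgE -mulg_set1 !mulgA.
  rewrite -(card_imset [set (L :* x * H)%g | x in G] (@rcoset_inj _ g)).
  apply: eq_card => D; apply/idP/idP=> /imsetP[x Gx ->].
    rewrite shift; apply/imset_f/imset_f; by rewrite groupM ?groupV.
  case/imsetP: Gx => y Gy ->; apply/imsetP; exists (y * g)%g.
    by rewrite groupM.
  by rewrite shift mulgK.
have eqP : is_tensor_induction (-1 : burnside H') =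
           is_tensor_induction (-1 : burnside H) :> (burnside G -> Prop).
  apply/funext=> u; apply/propext; rewrite !is_tensor_inductionN1.
  by split=> -[Uu uE]; split=> // L sLG; rewrite uE // cardE.
by rewrite /tensor_induction eqP.
Qed.

Lemma size_diff_poly n (p : {poly int}) :
  (size p <= n.+1)%N -> (size (p - (p \Po ('X + 1)))%R <= n)%N.
Proof.
move=> le_p; have size_X1 : size ('X + 1 : {poly int}) = 2 by rewrite size_XaddC.
have size_c : size (p \Po ('X + 1)) = size p by apply: size_comp_poly2.
apply/leq_sizeP => j le_nj; rewrite coefB.
have [le_j | lt_j] := leqP (size p) j.
  by rewrite !nth_default ?size_c // subrr.
have ej : j = (size p).-1 by lia.
have -> : (p \Po ('X + 1))`_j = lead_coef (p \Po ('X + 1)).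
  by rewrite lead_coefE size_c ej.
have -> : p`_j = lead_coef p by rewrite lead_coefE ej.
by rewrite lead_coef_comp ?size_X1 // lead_coefXaddC expr1n mulr1 subrr.
Qed.

Lemma alternating_sum n (p : {poly int}) : (size p <= n)%N ->
  \sum_(j < n.+1) (-1) ^+ j * 'C(n, j)%:R * p.[j%:R - 1] = 0.
Proof.
elim: n p => [|n IHn] p.
  rewrite leqn0 size_poly_eq0 => /eqP->.
  by rewrite big_ord_recl big_ord0 horner0 mulr0 addr0.
move=> /size_diff_poly/IHn.
under eq_bigr do rewrite hornerD hornerN horner_comp !hornerE mulrBr subrK.
rewrite sumrB => sum0; rewrite -[RHS]sum0 big_ord_recl.
under [X in _ + X]eq_bigr => j _.
  rewrite lift0 binS natrD mulrDr mulrDl exprS !mulN1r !mulNr -natr1 addrK.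
  over.
rewrite big_split /= !sumrN addrA; congr (_ + _).
rewrite [RHS]big_ord_recl big_ord_recr /= (bin_small (ltnSn n)) mulr0n mulr0 mul0r addr0.
rewrite !bin0; congr (_ + _); rewrite -sumrN; apply: eq_bigr => j _.
by rewrite /bump leq0n add1n exprS mulN1r !mulNr -natr1 addrK.
Qed.

Lemma alternating_sum_expr n m : (m <= n)%N ->
  \sum_(k < n.+1) (-1) ^+ k * 'C(n.+1, k.+1)%:R * k%:R ^+ m = (-1) ^+ m :> int.
Proof.
move=> le_mn; have := @alternating_sum n.+1 'X^m.
rewrite size_polyXn ltnS => /(_ le_mn); rewrite big_ord_recl.
rewrite hornerXn bin0 expr0 !mul1r sub0r => /eqP.
rewrite addr_eq0 => /eqP->; rewrite -sumrN; apply: eq_bigr => k _.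
by rewrite hornerXn lift0 exprS mulN1r !mulNr opprK -natr1 addrK.
Qed.

Section PowerAction.
Variables (T : finType) (to : action G T) (k : nat).

Definition pow_act (f : {ffun T -> 'I_k}) (a : gT) :=
  [ffun x => f (to x a^-1%g)].

Lemma pow_act_is_action : is_action G pow_act.
Proof.
split=> [a f f' /ffunP eq_f|f a b Ga Gb]; apply/ffunP=> x.
  have inj_a : injective (to^~ a^-1%g) by apply: act_inj.
  have [h _ hK] := injF_bij inj_a.
  by have := eq_f (h x); rewrite !ffunE /= hK.
by rewrite !ffunE invMg actMin ?groupV.
Qed.

Definition pow_action : action G {ffun T -> 'I_k} := Action pow_act_is_action.

Lemma card_afix_pow (L : {group gT}) : L \subset G ->
  #|'Fix_pow_action(L)| = (k ^ #|orbit to L @: setT|)%N.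
Proof.
move=> sLG; set P := orbit to L @: setT.
have in_P x : orbit to L x \in P by apply: imset_f.
pose F (g : {ffun {A | A \in P} -> 'I_k}) : {ffun T -> 'I_k} :=
  [ffun x => g (exist _ (orbit to L x) (in_P x))].
have F_inj : injective F.
  move=> g g' /ffunP eqF; apply/ffunP=> -[A PA].
  have /imsetP[x _ defA] := PA; have := eqF x; rewrite !ffunE.
  have -> : exist _ (orbit to L x) (in_P x) = exist (fun A => A \in P) A PA.
    by apply: val_inj.
  by [].
have -> : 'Fix_pow_action(L) = F @: setT.
  apply/setP=> f; rewrite afixE inE; apply/forall_inP/imsetP=> [fixf|[g _ ->] a La].
    have rep (A : {A | A \in P}) : {x : T | orbit to L x = val A}.
      by apply/cid; have /imsetP[x _ ->] := valP A; exists x.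
    exists [ffun A => f (projT1 (rep A))] => //; apply/ffunP=> x; rewrite !ffunE.
    case: (rep _) => y /= eq_orb.
    have : y \in orbit to L x by rewrite -eq_orb orbit_refl.
    case/imsetP=> a La ->.
    have /eqP/ffunP/(_ (to x a)) := fixf a La; rewrite ffunE => <-.
    by rewrite (actKin to (subsetP sLG a La)).
  apply/eqP/ffunP=> x; rewrite !ffunE; congr (g _); apply: val_inj => /=.
  apply/(orbit_in_eqP sLG); rewrite mem_orbit ?groupV //.
by rewrite card_imset // cardsT card_ffun card_ord card_sig.
Qed.

End PowerAction.

Lemma card_imset_ker (T U V : finType) (f : T -> U) (g : T -> V) :
  (forall x y, f x = f y <-> g x = g y) -> #|f @: setT| = #|g @: setT|.
Proof.
move=> fg; rewrite -(card_imset (g @: setT) set1_inj).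
pose h u := [set g x | x in [set x | f x == u]].
have hE x : h (f x) = [set g x].
  apply/setP=> v; rewrite inE; apply/imsetP/eqP=> [[y]|->].
    by rewrite inE => /eqP/fg <- ->.
  by exists x; rewrite ?inE.
rewrite -(@card_in_imset _ _ h) => [|_ _ /imsetP[x _ ->] /imsetP[y _ ->]].
  by rewrite -!imset_comp; congr #|pred_of_set _|; apply: eq_imset => x /=.
by rewrite !hE => /set1_inj/fg.
Qed.

Lemma card_orbits_coset (H L : {group gT}) : L \subset G ->
  #|orbit (coset_action G H) L @: setT| = #|[set (L :* x * H)%g | x in G]|.
Proof.
move=> sLG; pose g (A : {A | A \in rcosets H G}) := ((val A * L)^-1)%g.
rewrite (@card_imset_ker _ _ _ _ g) => [|A B].
  congr #|pred_of_set _|; apply/setP=> D; apply/idP/idP=> /imsetP[].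
    move=> [A rA] _ ->; have /rcosetsP[x Gx defA] := rA.
    apply/imsetP; exists x^-1%g; rewrite ?groupV // /g /= defA.
    by rewrite !invMg !invGid invg_set1 mulgA.
  move=> x Gx ->; have rA : (H :* x^-1)%g \in rcosets H G.
    by apply/rcosetsP; exists x^-1%g; rewrite ?groupV.
  apply/imsetP; exists (exist (fun A => A \in rcosets H G) _ rA) => //.
  by rewrite /g /= !invMg !invGid invg_set1 invgK mulgA.
rewrite /g; split=> [/(orbit_in_eqP sLG)/imsetP[l Ll ->]|/invg_inj eAB].
  have lL : ([set l] * L)%g = L by apply: lcoset_id.
  by rewrite val_coset_action ?(subsetP sLG) // -mulgA lL.
apply/(orbit_in_eqP sLG); have /rcosetsP[x Gx defA] := valP A.
have /rcosetsP[y Gy defB] := valP B.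
have : x \in (val B * L)%g.
  by rewrite -eAB defA -[x]mulg1 mem_mulg ?mulg1 ?rcoset_refl.
case/mulsgP=> b l Bb Ll defx; apply/imsetP; exists l => //.
apply: val_inj; rewrite val_coset_action ?(subsetP sLG) //.
rewrite defA defx rcosetM; congr (_ :* _)%g.
by move: Bb; rewrite defB => /rcoset_eqP.
Qed.

Lemma is_tensor_inductionN1_exists (H : {group gT}) :
  exists u : burnside G, is_tensor_induction (-1 : burnside H) u.
Proof.
set to := coset_action G H; set N := #|[set: {A : {set gT} | A \in rcosets H G}]|.
pose u : burnside G := \sum_(k < N.+1)
   ((-1) ^+ k * 'C(N.+1, k.+1)%:R) * gset_class (pow_action to k).
have markE (L : {group gT}) : L \subset G ->
    mark L u = (-1) ^+ #|[set (L :* x * H)%g | x in G]|.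
  move=> sLG; rewrite -card_orbits_coset //.
  have mark0 : mark L (0 : burnside G) = 0.
    by rewrite -(subrr (1 : burnside G)) markD // markN // subrr.
  have markX (a : burnside G) n : mark L (a ^+ n) = mark L a ^+ n.
    by elim: n => [|n IHn]; rewrite ?mark1 // !exprS markM // IHn.
  have markn n : mark L (n%:R : burnside G) = n%:R.
    by elim: n => [|n IHn] //; rewrite -!natr1 markD // IHn mark1.
  rewrite -(@alternating_sum_expr N); last first.
    exact: leq_imset_card.
  rewrite /u (big_morph (mark L) (markD sLG) mark0); apply: eq_bigr => k _.
  rewrite !markM // markX markN // mark1 // markn mark_gset_class //.
  by rewrite card_afix_pow // -natz natrX.
have u2 : u * u = 1.
  apply: mark_inj => L sLG; rewrite markM // markE // mark1 //.
  by rewrite -expr2 -exprM mulnC exprM sqrrN expr1n.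
exists u; apply/is_tensor_inductionN1; split=> //.
by apply/unitrP; exists u.
Qed.

Lemma tensor_inductionN1P (H : {group gT}) :
  is_tensor_induction (-1 : burnside H)
    (tensor_induction G (-1 : burnside H)).
Proof.
have [u ten_u] := is_tensor_inductionN1_exists H.
by rewrite (tensor_inductionE ten_u).
Qed.

End TensorInductionOfN1.

Section ExponentialMap.

Variables (gT : finGroupType) (G : {group gT}).

(* The value at [X] of the homomorphism sending [G/H] to Ten_H^G(-1): X is the
   disjoint union of its orbits, and the orbit of x is G/Stab(x). *)
Definition exp_action (T : finType) (to : action G T) : burnside G :=
  \prod_(x in orbit_transversal to G setT)
     tensor_induction G (-1 : burnside 'C_G[x | to]%G).

Definition exp_map (a : burnside G) : burnside G :=
  exp_action (gclass_act (repr a).1) / exp_action (gclass_act (repr a).2).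

Lemma exp_action_unit (T : finType) (to : action G T) :
  exp_action to \is a GRing.unit.
Proof.
apply: (big_ind (fun u : burnside G => u \is a GRing.unit)) => [|u v Uu Uv|x _].
- exact: unitr1.
- by rewrite unitrM Uu.
- exact: tensor_induction_unit.
Qed.

Lemma exp_map_unit a : exp_map a \is a GRing.unit.
Proof. by rewrite unitrM unitrV !exp_action_unit. Qed.

Lemma transversalP (T : finType) (to : action G T)
    (X := orbit_transversal to G setT) :
  {in X &, forall x y, y \in orbit to G x -> x = y} /\
  forall x, exists2 a, a \in G & to x a \in X.
Proof.
have actT : [acts G, on [set: T] | to].
  by apply/subsetP=> a Ga; rewrite !inE Ga; apply/subsetP=> x _; rewrite !inE.
have [_ _ X_inj X_ex] := orbit_transversalP actT.
split=> [x y Xx Xy|x]; first by rewrite X_inj // => /eqP.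
exact: X_ex.
Qed.

Lemma prod_section (T T' : finType) (to : action G T) (to' : action G T')
    (S : {set T}) (S' : {set T'}) (f : T -> T') (F : T' -> burnside G) :
    (forall x a, a \in G -> f (to x a) = to' (f x) a) -> injective f ->
    (forall y a, a \in G -> F (to' y a) = F y) ->
    {in S &, forall x y, y \in orbit to G x -> x = y} ->
    {in S' &, forall x y, y \in orbit to' G x -> x = y} ->
    (forall x, x \in S -> exists2 a, a \in G & to' (f x) a \in S') ->
    (forall y, y \in S' -> exists2 x, x \in S & f x \in orbit to' G y) ->
  \prod_(x in S) F (f x) = \prod_(y in S') F y.
Proof.
move=> fE f_inj F_inv S_inj S'_inj S_S' S'_S.
pose h x := if [pick a in G | to' (f x) a \in S'] is Some a
            then to' (f x) a else f x.
have hP x : x \in S -> exists2 a, a \in G & h x = to' (f x) a /\ h x \in S'.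
  move=> Sx; rewrite /h; case: pickP => [a /andP[Ga S'a]|no_a]; first by exists a.
  by have [a Ga S'a] := S_S' x Sx; have := no_a a; rewrite Ga S'a.
have h_inj : {in S &, injective h}.
  move=> x y Sx Sy; have [a Ga [-> _]] := hP x Sx.
  have [b Gb [-> _]] := hP y Sy; rewrite -!fE // => /f_inj eq_xy.
  apply: S_inj => //; apply/orbitP; exists (a * b^-1)%g.
    by rewrite groupM ?groupV.
  by rewrite actMin ?groupV // eq_xy actKin.
have -> : S' = h @: S.
  apply/setP=> y; apply/idP/imsetP=> [S'y|[x Sx ->]]; last first.
    by have [a _ []] := hP x Sx.
  have [x Sx /orbitP[b Gb yb]] := S'_S y S'y; exists x => //.
  have [a Ga [hx S'hx]] := hP x Sx; apply: S'_inj => //.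
  by apply/orbitP; exists (b * a)%g; rewrite ?groupM // actMin // yb.
rewrite big_imset //=; apply: eq_bigr => x Sx.
by have [a Ga [-> _]] := hP x Sx; rewrite F_inv.
Qed.

Let stab_val (T : finType) (to : action G T) (x : T) : burnside G :=
  tensor_induction G (-1 : burnside 'C_G[x | to]%G).

Lemma stab_val_act (T : finType) (to : action G T) x a :
  a \in G -> stab_val to (to x a) = stab_val to x.
Proof.
move=> Ga; apply: (tensor_inductionN1_conj Ga).
apply/setP=> b; rewrite mem_conjg /= !in_stab groupJr ?groupV //.
case Gb: (b \in G) => //=; rewrite conjgE invgK !actMin ?groupM ?groupV //.
by rewrite -(inj_eq (act_inj to a) (to _ _) x) actKVin.
Qed.

Lemma stab_val_inj (T T' : finType) (to : action G T) (to' : action G T')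
    (f : T -> T') x : injective f ->
    (forall x a, a \in G -> f (to x a) = to' (f x) a) ->
  stab_val to x = stab_val to' (f x).
Proof.
move=> f_inj fE; apply: (tensor_inductionN1_conj (group1 G)).
rewrite conjsg1; apply/setP=> b /=; rewrite !in_stab.
by case Gb: (b \in G) => //=; rewrite -fE // (inj_eq f_inj).
Qed.

Lemma exp_action_section (T : finType) (to : action G T) (S : {set T}) :
    {in S &, forall x y, y \in orbit to G x -> x = y} ->
    (forall x, exists2 a, a \in G & to x a \in S) ->
  exp_action to = \prod_(x in S) stab_val to x.
Proof.
move=> S_inj S_ex; have [X_inj X_ex] := transversalP to.
apply: (@prod_section _ _ to to _ _ id) => // [y a|y _].
  exact: stab_val_act.
by have [a Ga Xa] := X_ex y; exists (to y a) => //; apply: mem_orbit.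
Qed.

Lemma exp_action_iso (T T' : finType) (to : action G T) (to' : action G T') :
  act_iso to to' -> exp_action to = exp_action to'.
Proof.
move=> [f f_bij fE]; have f_inj := bij_inj f_bij; have [g gK fK] := f_bij.
have [X_inj X_ex] := transversalP to; have [X'_inj X'_ex] := transversalP to'.
rewrite /exp_action; under eq_bigr do rewrite -/(stab_val _ _) (stab_val_inj _ f_inj fE).
apply: (prod_section fE f_inj) => // [y a|y _]; first exact: stab_val_act.
have [a Ga Xa] := X_ex (g y); exists (to (g y) a) => //.
by rewrite fE // fK mem_orbit.
Qed.

Lemma exp_action_sum (T T' : finType) (to : action G T) (to' : action G T') :
  exp_action (sum_action to to') = exp_action to * exp_action to'.
Proof.
have [X_inj X_ex] := transversalP (sum_action to to').
set X := orbit_transversal _ _ _ in X_inj X_ex.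
rewrite (@exp_action_section _ to [set x | inl x \in X]); first last.
- move=> x; have [a Ga Xa] := X_ex (inl x).
  by exists a => //; rewrite inE.
- move=> x y; rewrite !inE => Xx Xy /orbitP[a Ga xa].
  by apply: (@inl_inj _ T'); apply: X_inj => //; apply/orbitP; exists a; rewrite //= xa.
rewrite (@exp_action_section _ to' [set x | inr x \in X]); first last.
- move=> x; have [a Ga Xa] := X_ex (inr x).
  by exists a => //; rewrite inE.
- move=> x y; rewrite !inE => Xx Xy /orbitP[a Ga xa].
  by apply: (@inr_inj T); apply: X_inj => //; apply/orbitP; exists a; rewrite //= xa.
rewrite /exp_action big_sumType; congr (_ * _).
  apply: eq_big => x; first by rewrite inE.
  by move=> _; rewrite -/(stab_val _ _); apply/esym/stab_val_inj => //; apply: inl_inj.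
apply: eq_big => x; first by rewrite inE.
by move=> _; rewrite -/(stab_val _ _); apply/esym/stab_val_inj => //; apply: inr_inj.
Qed.

Lemma exp_actionD (x y : gclass G) :
  exp_action (gclass_act (x + y)) =
  exp_action (gclass_act x) * exp_action (gclass_act y).
Proof.
rewrite -exp_action_sum; apply: exp_action_iso; exact: act_iso_repr.
Qed.

Lemma exp_map_gdiff (x y : gclass G) :
  exp_map (gdiff x y) =
  exp_action (gclass_act x) / exp_action (gclass_act y).
Proof.
have [z] := repr_gdiff x y; rewrite /exp_map; move: (repr _) => u.
move=> /(congr1 (fun w => exp_action (gclass_act w))); rewrite !exp_actionD.
move/(mulIr (exp_action_unit _)) => eq_xu.
apply: (canLR (mulrK (exp_action_unit _))).
rewrite mulrAC; apply: (canRL (mulrK (exp_action_unit _))).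
exact: eq_xu.
Qed.

Lemma exp_mapD : {morph exp_map : a b / a + b >-> a * b}.
Proof.
move=> a b; rewrite -[a]gdiff_repr -[b]gdiff_repr gdiffD !exp_map_gdiff.
by rewrite !exp_actionD invrM ?exp_action_unit // [(exp_action _)^-1 * _]mulrC mulrACA.
Qed.

Lemma exp_map_gset (T : finType) (to : action G T) :
  exp_map (gset_class to) = exp_action to.
Proof.
rewrite exp_map_gdiff (exp_action_iso (act_iso_repr to)).
rewrite (exp_action_iso (act_iso_repr _)) [exp_action (triv_action _ _)]big1.
  by rewrite divr1.
by case.
Qed.

Lemma exp_map_coset (H : {group gT}) : H \subset G ->
  exp_map (gset_class (coset_action G H)) =
  tensor_induction G (-1 : burnside H).
Proof.
move=> sHG; rewrite exp_map_gset.
have rH : (H : {set gT}) \in rcosets H G.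
  by apply/rcosetsP; exists 1%g; rewrite ?mulg1.
pose c : {A : {set gT} | A \in rcosets H G} :=
  exist (fun A => A \in rcosets H G) _ rH.
rewrite (@exp_action_section _ _ [set c]) => [|x y|A].
- rewrite big_set1; apply: (tensor_inductionN1_conj (group1 G)).
  rewrite conjsg1; apply/setP=> b /=; rewrite in_stab.
  case Gb: (b \in G) => /=; last by apply/esym/(contraFF _ Gb)/subsetP.
  rewrite -val_eqE val_coset_action //=.
  apply/eqP/idP=> [<-|Hb]; first exact: rcoset_refl.
  exact: rcoset_id.
- by move=> /set1P-> /set1P->.
have /rcosetsP[x Gx defA] := valP A; exists x^-1%g; rewrite ?groupV // inE.
by rewrite -val_eqE val_coset_action ?groupV //= defA rcosetK.
Qed.

End ExponentialMap.

(* Main.v *)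
(* Let R_k = <r^k> and L_{k,i} = <r^k, s r^i> for k dividing n; these are all the
   subgroups of the dihedral group.  Burnside-type congruences for the marks of a
   unit show that its values on the R_k depend only on the parity of k, and that
   for even k they determine the product of the values at L_{k,0} and L_{k,1}.
   Hence the unit group is generated by -1, Ten(-1) from L_{2,0} (n even) and, for
   d | n, the units u_d with mark -1 exactly at the L_{k,i} with d | k.
   Parities of double coset counts show that u_d lies in the image when d is 1, 2,
   4, p^j or 2p^j with p = 3 mod 4, and these are the only divisors of n when
   phi(n) = 2 mod 4.  Otherwise the product of the marks at L_{k,0}, for k ranging
   over one of {1, p} (p = 1 mod 4), {1, p, q, pq}, {2, 4, 2p, 4p}, {4, 8}, is
   trivial on the image, but not on u_d for d the largest of these k. *)
Require Import Defs.
From mathcomp Require Import all_boot all_order all_fingroup all_algebra all_solvable.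
From mathcomp Require Import boolp.
From mathcomp Require Import ring zify.

Set Implicit Arguments.
Unset Strict Implicit.
Unset Printing Implicit Defensive.

Import GRing.Theory Num.Theory.
Local Open Scope group_scope.
Local Open Scope ring_scope.

(** * Marks and the Burnside congruences *)

Section Marks.

Variables (gT : finGroupType) (G : {group gT}).
Implicit Types (L N K H : {group gT}) (a u : burnside G).

(** Translation by $x$ maps the fixed points of $L$ bijectively onto those of $L^x$. *)
Lemma card_afix_conj L x (T : finType) (to : action G T) :
  L \subset G -> x \in G -> #|'Fix_to((L :^ x)%g)| = #|'Fix_to(L)|.
Proof.
move=> sLG Gx; rewrite -(card_imset 'Fix_to(L) (act_inj to x)).
apply: eq_card => t; rewrite -[t](actKVin to Gx) (mem_imset _ _ (act_inj to x)).
have actJ v b : b \in G -> (to (to v x) (b ^ x)%g == to v x) = (to v b == v).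
  move=> Gb; rewrite -[RHS](inj_eq (act_inj to x)) -!actMin ?groupJ //.
  by rewrite -conjgC.
rewrite !afixE !inE; apply/forall_inP/forall_inP => fix_t b Lb.
  by rewrite -actJ ?(subsetP sLG) // fix_t // memJ_conjg.
move: Lb; rewrite mem_conjg => Lb.
by rewrite -[b](conjgKV x) actJ ?fix_t // (subsetP sLG).
Qed.

Lemma mark_conj L x a :
  L \subset G -> x \in G -> mark (L :^ x)%g a = mark L a.
Proof. by move=> sLG Gx; rewrite /mark /gmark !card_afix_conj. Qed.

(** Orbit counting for $K$ acting on the fixed points of $N$: these are $K$-stable since $K$
    normalises $N$, and those among them fixed by $g$ are the fixed points of the join of $N$ and
    $\langle g\rangle$. *)
Lemma dvdn_sum_card_afix N K (T : finType) (to : action G T) :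
  K \subset G -> N \subset K -> K \subset 'N(N)%g ->
  (#|K| %| \sum_(g in K) #|'Fix_to(N <*> <[g]>)|)%N.
Proof.
move=> sKG sNK nNK; have sNG := subset_trans sNK sKG.
have actsK : [acts K, on 'Fix_to(N) | to].
  have := acts_subnorm_fix to N; rewrite (setIidPr sNG).
  by apply: subset_trans; rewrite subsetI sKG.
have := Frobenius_Cauchy actsK.
set F := (X in (X = _)%N) => FE; suff -> : (\sum_(g in K) #|'Fix_to(N <*> <[g]>)|)%N = F.
  by rewrite FE dvdn_mull.
apply: eq_bigr => g Kg; have Gg := subsetP sKG g Kg.
by rewrite afixYin ?cycle_subG // afix_cycle_in.
Qed.

Lemma dvdz_sum_mark N K a :
  K \subset G -> N \subset K -> K \subset 'N(N)%g ->
  (#|K| %| \sum_(g in K) mark (N <*> <[g]>) a)%Z.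
Proof.
move=> sKG sNK nNK; rewrite /mark sumrB -!(big_morph Posz PoszD (erefl _)).
by apply: rpredB; apply: dvdn_sum_card_afix.
Qed.

Lemma mark_unit L u : L \subset G -> u \is a GRing.unit ->
  mark L u = 1 \/ mark L u = -1.
Proof.
move=> sLG Uu; have := markM sLG u u^-1; rewrite divrr // mark1 //.
by move/(congr1 absz); rewrite abszM => /esym/eqP; rewrite muln_eq1; lia.
Qed.

Lemma mark_tensorN1 L H : L \subset G ->
  mark L (tensor_induction G (-1 : burnside H)) =
  (-1) ^+ #|[set (L :* x * H)%g | x in G]|.
Proof.
by have /is_tensor_inductionN1[_] := @tensor_inductionN1P _ G H; apply.
Qed.

End Marks.

(** * Counting double cosets *)

Section DoubleCosets.

Variables (gT : finGroupType) (G L H : {group gT}).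

Lemma mem_dcosetP x y :
  reflect (exists l h, [/\ l \in L, h \in H & y = (l * x * h)%g])
          (y \in (L :* x * H)%g).
Proof.
apply: (iffP mulsgP) => [[z h /rcosetP[l Ll ->] Hh ->]|[l [h [Ll Hh ->]]]].
  by exists l, h.
by exists (l * x)%g h => //; apply/rcosetP; exists l.
Qed.

Lemma dcoset_eq x y : y \in (L :* x * H)%g -> (L :* y * H = L :* x * H)%g.
Proof.
case/mem_dcosetP=> l [h [Ll Hh ->]].
by rewrite !rcosetM rcoset_id // -mulgA lcoset_id.
Qed.

Lemma dcoset_refl x : x \in (L :* x * H)%g.
Proof. by apply/mem_dcosetP; exists 1%g, 1%g; rewrite mul1g mulg1. Qed.

Lemma card_dcosets_reps m (f : nat -> gT) :
    (forall a, f a \in G) ->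
    (forall x, x \in G -> exists2 a, (a < m)%N & f a \in (L :* x * H)%g) ->
    (forall a b, (a < m)%N -> (b < m)%N -> f b \in (L :* f a * H)%g -> a = b) ->
  #|[set (L :* x * H)%g | x in G]| = m.
Proof.
move=> Gf f_ex f_inj; rewrite -[m in RHS]card_ord.
rewrite -(@card_imset _ _ (fun a : 'I_m => L :* f a * H)%g) => [|a b /= eq_ab].
  apply: eq_card => D; apply/imsetP/imsetP=> [[x Gx ->]|[a _ ->]].
    by have [a lt_am fa] := f_ex x Gx; exists (Ordinal lt_am); rewrite //= (dcoset_eq fa).
  by exists (f a).
by apply: val_inj; apply: f_inj => //=; rewrite eq_ab dcoset_refl.
Qed.

End DoubleCosets.

(** Inversion exchanges $LxH$ and $Hx^{-1}L$. *)
Lemma card_dcosets_sym (gT : finGroupType) (G L H : {group gT}) :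
  #|[set (L :* x * H)%g | x in G]| = #|[set (H :* x * L)%g | x in G]|.
Proof.
rewrite -(card_imset _ (@invg_inj _)); apply: eq_card => D.
have dcV (A B : {group gT}) x : ((A :* x * B)^-1 = B :* x^-1 * A)%g.
  by rewrite !invMg !invGid invg_set1 mulgA.
apply/imsetP/imsetP=> [[E /imsetP[x Gx ->] ->]|[x Gx ->]].
  by exists x^-1%g; rewrite ?groupV.
by exists (L :* x^-1 * H)%g; rewrite ?dcV ?invgK //; apply: imset_f; rewrite groupV.
Qed.

(** * Residues and divisibility of small integers *)

Lemma dvdz_small (g : nat) (x : int) : (g %| x)%Z -> (`|x| < g)%N -> x = 0.
Proof.
rewrite /dvdz /= => g_x lt_xg; apply/eqP; rewrite -absz_eq0.
by apply: contraLR g_x; rewrite -lt0n => x0; rewrite -[X in ~~ X]/(g %| `|x|)%N gtnNdvd.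
Qed.

Lemma dvdz_sub_small (g a b : nat) : (a < g)%N -> (b < g)%N ->
  (g %| b%:Z - a%:Z)%Z -> a = b.
Proof. by move=> lt_a lt_b /dvdz_small H; lia. Qed.

Lemma dvdz_add_small (g a b : nat) : (0 < a + b)%N -> (a + b < g.*2)%N ->
  (g %| b%:Z + a%:Z)%Z -> (a + b = g)%N.
Proof.
move=> ab0 ab_lt g_ab; suff : b%:Z + a%:Z - g%:Z = 0 by lia.
by apply: (@dvdz_small g); [rewrite rpredB ?dvdzz | lia].
Qed.

(** Bezout; the two summands later become the exponents of the left and right factors in a double
    coset. *)
Lemma gcdn_dvdzP (k d : nat) (z : int) : (gcdn k d %| z)%Z ->
  exists x y, (k %| x)%Z /\ (d %| y)%Z /\ z = x + y.
Proof.
case/dvdzP=> q ->; have [u [v]] := Bezoutz k d.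
rewrite /gcdz /= => <-; exists (q * u * k), (q * v * d).
by rewrite !dvdz_mull // mulrDr !mulrA.
Qed.

Lemma modz_rep (g : nat) z : (0 < g)%N -> exists2 a : nat, (a < g)%N & (g %| a%:Z - z)%Z.
Proof.
move=> g0; have gz : g%:Z != 0 by lia.
exists `|(z %% g)%Z|%N; first by lia.
rewrite gez0_abs ?modz_ge0 //.
by rewrite -eqz_mod_dvd modz_mod.
Qed.

(** * Elements and subgroups of a dihedral group *)

Section Dihedral.

Variables (gT : finGroupType) (G : {group gT}) (n : nat) (r s : gT).

(** All that is used about the dihedral group; [dihedral_generators] provides such a pair in
    ['D_(n.*2)]. *)
Definition dihedral_pair : Prop :=
  [/\ r \in G, s \in G, s \notin <[r]>%g, (s * s = 1)%g & (r ^ s = r^-1)%g]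
  /\ (0 < n)%N /\ #[r]%g = n /\ #|G| = n.*2.

Hypothesis dihG : dihedral_pair.

Let Gr : r \in G. Proof. by case: dihG => -[]. Qed.
Let Gs : s \in G. Proof. by case: dihG => -[]. Qed.
Let sNr : s \notin <[r]>%g. Proof. by case: dihG => -[]. Qed.
Let s2 : (s * s = 1)%g. Proof. by case: dihG => -[]. Qed.
Let rs : (r ^ s = r^-1)%g. Proof. by case: dihG => -[]. Qed.
Let n_gt0 : (0 < n)%N. Proof. by case: dihG => _ []. Qed.
Let or : #[r]%g = n. Proof. by case: dihG => _ [_ []]. Qed.
Let oG : #|G| = n.*2. Proof. by case: dihG => _ [_ []]. Qed.

(** Integer exponents make [rho] a homomorphism from the integers to the rotations, so that
    exponents can be handled by [ring]. *)
Definition rho (z : int) : gT := (r ^+ `|(z %% n)%Z|)%g.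

Let nz : n%:Z != 0. Proof. by lia. Qed.

Lemma rho_nat (a : nat) : rho a = (r ^+ a)%g.
Proof. by rewrite /rho modz_nat /= -or expg_mod_order. Qed.

Lemma rhoD x y : rho (x + y) = (rho x * rho y)%g.
Proof.
rewrite {2 3}/rho -expgD -rho_nat PoszD !gez0_abs ?modz_ge0 //.
by rewrite /rho modzDm.
Qed.

Lemma rho0 : rho 0 = 1%g. Proof. exact: (rho_nat 0). Qed.

Lemma rhoN x : rho (- x) = (rho x)^-1%g.
Proof. by apply/eqP; rewrite eq_sym eq_invg_mul -rhoD subrr rho0. Qed.

Lemma rhoM (x : int) (a : nat) : rho (x * a%:Z) = (rho x ^+ a)%g.
Proof.
elim: a => [|a IHa]; first by rewrite mulr0 rho0.
by rewrite intS mulrDr mulr1 rhoD IHa expgS.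
Qed.

Lemma rho_s z : (rho z * s = s * rho (- z))%g.
Proof.
by rewrite rhoN conjgC /rho conjXg rs expgVn.
Qed.

Lemma rho_eq1 z : (rho z == 1%g) = (n %| z)%Z.
Proof.
rewrite -order_dvdn or; change ((n %| (z %% n)%Z)%Z = (n %| z)%Z).
by rewrite (sameP dvdz_mod0P eqP) modz_mod (sameP eqP dvdz_mod0P). Qed.

Lemma rho_in z : rho z \in <[r]>%g.
Proof. exact: mem_cycle. Qed.

Lemma cycle_rhoP x : reflect (exists z, x = rho z) (x \in <[r]>%g).
Proof.
apply: (iffP idP) => [/cycleP[a ->]|[z ->]]; last exact: rho_in.
by exists a%:Z; rewrite rho_nat.
Qed.

Lemma s_rho_notin z : (s * rho z)%g \in <[r]>%g = false.
Proof. by rewrite groupMr ?rho_in // (negbTE sNr). Qed.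

Lemma sub_rG : <[r]>%g \subset G. Proof. by rewrite cycle_subG. Qed.

Lemma rho_G z : rho z \in G. Proof. exact: subsetP sub_rG _ (rho_in z). Qed.

(** The rotations have index 2, so everything else lies in their coset of $s$. *)
Lemma dihP x : x \in G -> (exists z, x = rho z) \/ (exists z, x = s * rho z)%g.
Proof.
move=> Gx; case rx: (x \in <[r]>%g); first by left; apply/cycle_rhoP.
right; have ir : #|G : <[r]>%g| = 2.
  by rewrite -divgS ?sub_rG // oG -orderE or -muln2 mulKn.
have : x \in (<[r]>%g :* s)%g.
  by rewrite (rcoset_index2 sub_rG ir) !inE ?sNr // rx.
case/rcosetP=> y /cycle_rhoP[z ->] ->; exists (- z).
by rewrite rho_s.
Qed.

Lemma srhoD x z : (s * rho x * (s * rho z) = rho (z - x))%g.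
Proof. by rewrite mulgA -[(s * _ * s)%g]mulgA rho_s mulgA s2 mul1g -rhoD addrC. Qed.

Lemma rho_srho x z : (rho x * (s * rho z) = s * rho (z - x))%g.
Proof. by rewrite mulgA rho_s -mulgA -rhoD addrC. Qed.

Lemma srho_rho x z : (s * rho x * rho z = s * rho (x + z))%g.
Proof. by rewrite -mulgA -rhoD. Qed.

Definition rotg (k : nat) : {group gT} := <[r ^+ k]>%G.

Lemma rho_eq x y : (rho x == rho y) = (n %| y - x)%Z.
Proof. by rewrite eq_mulVg1 -rhoN -rhoD rho_eq1 addrC. Qed.

Lemma rho_rotg k z : (k %| n)%N -> (rho z \in rotg k) = (k %| z)%Z.
Proof.
move=> kn; apply/cycleP/idP=> [[a]|/dvdzP[q ->]].
  rewrite -expgM -rho_nat => /eqP; rewrite rho_eq.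
  have k_n : (k%:Z %| n%:Z)%Z by [].
  move=> /(dvdz_trans k_n) k_kaz; rewrite -[z](subKr (k * a)%:Z).
  by rewrite rpredB // PoszM dvdz_mulr.
exists `|(q %% n)%Z|%N; rewrite -expgM -rho_nat PoszM gez0_abs ?modz_ge0 //.
by rewrite /rho modzMmr mulrC.
Qed.

Lemma srho_rotg k z : ((s * rho z)%g \in rotg k) = false.
Proof.
apply: contraFF (s_rho_notin z); apply: subsetP.
by rewrite cycle_subG mem_cycle.
Qed.

Lemma srhoV z : ((s * rho z)^-1 = s * rho z)%g.
Proof. by apply/eqP; rewrite eq_invg_mul srhoD subrr rho0. Qed.

(** For $k\mid n$, [rotg k] and [dihg k i] are the $R_k$ and $L_{k,i}$ introduced at the start; $i$
    matters only modulo $k$. *)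
Definition dihg (k : nat) (i : int) : {group gT} :=
  (rotg k <*> <[s * rho i]>)%G.

Lemma rotg_norm k : G \subset 'N(rotg k).
Proof.
apply/subsetP=> x /dihP[[z ->]|[z ->]]; rewrite inE -cycleJ cycle_subG.
  rewrite conjgE -rho_nat -rhoN -!rhoD addrC addrK rho_nat; exact: cycle_id.
rewrite conjgE -rho_nat srhoV rho_srho srhoD addrC addKr.
by rewrite rhoN rho_nat groupV cycle_id.
Qed.

(** $R_k$ is normal and $sr^i$ has order 2, so the join is a product with two cosets of $R_k$. *)
Lemma dihgE k i : dihg k i = rotg k :|: (rotg k :* (s * rho i))%g :> {set gT}.
Proof.
have ot : #[s * rho i]%g = 2.
  apply: nt_prime_order => //; first by rewrite expgS expg1 srhoD subrr rho0.
  apply: contraFneq (s_rho_notin i) => ->; exact: group1.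
have -> : dihg k i = (rotg k * <[s * rho i]>)%g :> {set gT}.
  apply: norm_joinEr.
  by rewrite cycle_subG (subsetP (rotg_norm k)) // groupM ?rho_G.
by rewrite (cycle2g ot) mulgU mulg1.
Qed.

Lemma rho_dihg k i z : (k %| n)%N -> (rho z \in dihg k i) = (k %| z)%Z.
Proof.
move=> kn; rewrite dihgE inE rho_rotg // mem_rcoset srhoV.
by rewrite rho_srho srho_rotg orbF.
Qed.

Lemma srho_dihg k i z : (k %| n)%N ->
  ((s * rho z)%g \in dihg k i) = (k %| z - i)%Z.
Proof.
move=> kn; rewrite dihgE inE srho_rotg mem_rcoset srhoV srhoD rho_rotg //.
by rewrite -rpredN opprB.
Qed.

Lemma rotg_G k : rotg k \subset G.
Proof. by rewrite cycle_subG groupX. Qed.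

Lemma dihg_G k i : dihg k i \subset G.
Proof. by rewrite join_subG rotg_G cycle_subG groupM ?rho_G. Qed.

Lemma card_rotg k : (k %| n)%N -> #|rotg k| = (n %/ k)%N.
Proof. by move=> kn; rewrite -orderE orderXdiv or. Qed.

Lemma sub_dih_eq (A B : {group gT}) : A \subset G -> B \subset G ->
  (forall z, (rho z \in A) = (rho z \in B)) ->
  (forall z, ((s * rho z)%g \in A) = ((s * rho z)%g \in B)) -> A = B.
Proof.
move=> sAG sBG eq_rho eq_srho; apply/val_inj/setP => x /=.
case Gx: (x \in G); first by case/dihP: Gx => -[z ->].
by apply/idP/idP=> [/(subsetP sAG)|/(subsetP sBG)]; rewrite Gx.
Qed.

(** $L\cap\langle r\rangle$ is determined by its order, as $\langle r\rangle$ is cyclic; if $L$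
    contains a reflection $sr^i$, its other reflections are found by multiplying with $sr^i$. *)
Lemma subgroup_dih (L : {group gT}) : L \subset G ->
  exists k, (k %| n)%N /\ (L = rotg k \/ exists i, L = dihg k i).
Proof.
move=> sLG.
have [k [kn Lk]] : exists k, (k %| n)%N /\ (L :&: <[r]> = rotg k)%G.
  have m_n : (#|L :&: <[r]>| %| #[r])%N by rewrite cardSg ?subsetIr.
  exists (n %/ #|L :&: <[r]>|)%N; split; first by apply: dvdn_div; rewrite -[X in (_ %| X)%N]or.
  apply/set1P; have := cycle_sub_group m_n; rewrite or => <-.
  by rewrite inE subsetIr /=.
have rhoL z : (rho z \in L) = (k %| z)%Z.
  by rewrite -rho_rotg // -Lk inE rho_in andbT.
exists k; split=> //; case: (boolP (L \subset <[r]>%g)) => [sLr|].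
  left; apply: sub_dih_eq => // [|z|z]; first exact: rotg_G.
    by rewrite rhoL rho_rotg.
  rewrite srho_rotg; apply: contraFF (s_rho_notin z); exact: subsetP.
case/subsetPn=> x /= Lx nrx; right.
have /dihP[[z xE]|[i xE]] := subsetP sLG x Lx.
  by rewrite xE rho_in in nrx.
rewrite xE in Lx.
exists i; apply: sub_dih_eq => // [|z|z]; first exact: dihg_G.
  by rewrite rhoL rho_dihg.
by rewrite srho_dihg // -rhoL -srhoD (groupMl _ Lx).
Qed.

Lemma rotgJ k x : x \in G -> (rotg k :^ x)%g = rotg k.
Proof. by move=> Gx; apply: normP; apply: subsetP (rotg_norm k) _ Gx. Qed.

Lemma dihgJ k i z : (dihg k i :^ rho z)%g = dihg k (i + z *+ 2).
Proof.
rewrite !dihgE conjUg conjsMg rotgJ ?rho_G // conjg_set1 conjgE -rhoN.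
by rewrite srho_rho rho_srho opprK mulr2n addrA.
Qed.

Lemma rotgP k x : (k %| n)%N -> x \in rotg k -> exists2 u, (k %| u)%Z & x = rho u.
Proof.
move=> kn kx; have /dihP[[z xE]|[z xE]] := subsetP (rotg_G k) x kx.
  by exists z; rewrite // -rho_rotg // -xE.
by move: kx; rewrite xE srho_rotg.
Qed.

Lemma dihgP k i x : (k %| n)%N -> x \in dihg k i ->
  (exists2 u, (k %| u)%Z & x = rho u) \/ (exists2 u, (k %| u - i)%Z & x = s * rho u)%g.
Proof.
move=> kn kx; have /dihP[[z xE]|[z xE]] := subsetP (dihg_G k i) x kx.
  by left; exists z; rewrite // -(rho_dihg i) // -xE.
by right; exists z; rewrite // -srho_dihg // -xE.
Qed.

Lemma rho_neq_srho x y : (rho x == s * rho y)%g = false.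
Proof. by apply: contraFF (s_rho_notin y) => /eqP <-; apply: rho_in. Qed.

(** * Double cosets in the dihedral group *)

Lemma gcd_dvdz (k d : nat) (z : int) : (k %| z)%Z || (d %| z)%Z -> (gcdn k d %| z)%Z.
Proof.
by case/orP; apply: dvdz_trans; [exact: (dvdn_gcdl k d) | exact: (dvdn_gcdr k d)].
Qed.

Lemma gcd_dvdn_z (k d : nat) (z : int) : (k %| n)%N -> (n %| z)%Z -> (gcdn k d %| z)%Z.
Proof.
by move=> kn; apply: dvdz_trans; apply: (dvdn_trans (dvdn_gcdl k d) kn).
Qed.

Lemma rho_dcoset_rr k d a b : (k %| n)%N -> (d %| n)%N ->
  (rho b \in (rotg k :* rho a * rotg d)%g) = (gcdn k d %| b - a)%Z.
Proof.
move=> kn dn; apply/mem_dcosetP/idP=> [[l [h [+ + /eqP]]]|].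
  move=> /(rotgP kn)[u ku ->] /(rotgP dn)[v dv ->].
  rewrite -!rhoD rho_eq => /(gcd_dvdn_z d kn) gD.
  have -> : b - a = u + v - (u + a + v - b) by ring.
  by rewrite (rpredB _ gD) // rpredD // gcd_dvdz ?ku ?dv ?orbT.
case/gcdn_dvdzP=> x [y [kx [dy abE]]]; exists (rho x), (rho y).
by rewrite !rho_rotg // -!rhoD; split=> //; congr rho; rewrite addrAC -abE subrK.
Qed.

Lemma rho_dcoset_dr k d i a b : (k %| n)%N -> (d %| n)%N ->
  (rho b \in (dihg k i :* rho a * rotg d)%g) = (gcdn k d %| b - a)%Z.
Proof.
move=> kn dn; apply/idP/idP=> [/mem_dcosetP[l [h [+ + /eqP]]]|].
  move=> /(dihgP kn)[|] [u ku ->] /(rotgP dn)[v dv ->].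
    rewrite -!rhoD rho_eq => /(gcd_dvdn_z d kn) gD.
    have -> : b - a = u + v - (u + a + v - b) by ring.
    by rewrite (rpredB _ gD) // rpredD // gcd_dvdz ?ku ?dv ?orbT.
  by rewrite !srho_rho rho_neq_srho.
rewrite -rho_dcoset_rr //; apply: subsetP; do 2!apply: mulSg.
exact: joing_subl.
Qed.

(** A rotation arises from $r^a$ by two rotations, which shift the exponent, or by two reflections,
    which also reverse its sign; a mixed pair yields a reflection. *)
Lemma rho_dcoset_dd k d i j a b : (k %| n)%N -> (d %| n)%N ->
  (rho b \in (dihg k i :* rho a * dihg d j)%g) =
  (gcdn k d %| b - a)%Z || (gcdn k d %| b + a - (j - i))%Z.
Proof.
move=> kn dn; apply/idP/idP=> [/mem_dcosetP[l [h [+ + /eqP]]]|/orP[]].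
- move=> /(dihgP kn)[|] [u ku ->] /(dihgP dn)[|] [v dv ->].
  + rewrite -!rhoD rho_eq => /(gcd_dvdn_z d kn) gD.
    have -> : b - a = u + v - (u + a + v - b) by ring.
    by rewrite (rpredB _ gD) // rpredD // gcd_dvdz ?ku ?dv ?orbT.
  + by rewrite -rhoD rho_srho rho_neq_srho.
  + by rewrite !srho_rho rho_neq_srho.
  rewrite srho_rho srhoD rho_eq => /(gcd_dvdn_z d kn) gD; apply/orP; right.
  have -> : b + a - (j - i) = (v - j) - (u - i) - (v - (u + a) - b) by ring.
  by rewrite (rpredB _ gD) // rpredB // gcd_dvdz ?ku ?dv ?orbT.
- rewrite -(rho_dcoset_dr i) //; apply: subsetP; apply: mulgS.
  exact: joing_subl.
case/gcdn_dvdzP=> x [y [kx [dy abE]]]; apply/mem_dcosetP.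
(* Chosen so that the product has exponent $j+y-(i-x)-a$, which equals $b$ because
   $b+a-(j-i)=x+y$. *)
exists (s * rho (i - x))%g, (s * rho (j + y))%g.
rewrite !srho_dihg //; split; first by rewrite addrAC subrr sub0r rpredN.
  by rewrite addrAC subrr add0r.
rewrite srho_rho srhoD; congr rho.
have -> : b = (b + a - (j - i)) - a + j - i by ring.
by rewrite abE; ring.
Qed.

Lemma gcdn_gt0_l k d : (k %| n)%N -> (0 < gcdn k d)%N.
Proof. by move=> kn; rewrite gcdn_gt0 (dvdn_gt0 n_gt0). Qed.

(** Left multiplication by $sr^i$ turns reflections into rotations, so rotations represent all
    double cosets, and they are separated by their residue modulo the gcd. *)
Lemma card_dcosets_dr k d i : (k %| n)%N -> (d %| n)%N ->
  #|[set (dihg k i :* x * rotg d)%g | x in G]| = gcdn k d.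
Proof.
move=> kn dn; apply: (@card_dcosets_reps _ _ _ _ _ (fun a => rho a)) => [a|x|a b].
- exact: rho_G.
- have g0 := gcdn_gt0_l d kn.
  case/dihP=> -[z ->].
    by have [a lt_a ga] := modz_rep z g0; exists a; rewrite // rho_dcoset_dr.
  have [a lt_a ga] := modz_rep (z - i) g0; exists a => //.
  suff -> : (dihg k i :* (s * rho z) = dihg k i :* rho (z - i))%g.
    by rewrite rho_dcoset_dr.
  apply/rcoset_eqP; rewrite mem_rcoset -rhoN !srho_rho srho_dihg //.
  by rewrite addrAC subrr.
move=> lt_a lt_b; by rewrite rho_dcoset_dr //; apply: dvdz_sub_small.
Qed.

Lemma card_dcosets_rd k d j : (k %| n)%N -> (d %| n)%N ->
  #|[set (rotg k :* x * dihg d j)%g | x in G]| = gcdn k d.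
Proof. by move=> kn dn; rewrite card_dcosets_sym card_dcosets_dr // gcdnC. Qed.

(** Rotations and reflections are never in the same double coset and each kind gives $g$ of them;
    [f] lists the rotations at indices below $g$ and the reflections from $g$ on. *)
Lemma odd_card_dcosets_rr k d : (k %| n)%N -> (d %| n)%N ->
  odd #|[set (rotg k :* x * rotg d)%g | x in G]| = false.
Proof.
move=> kn dn; have g0 := gcdn_gt0_l d kn; set g := gcdn k d in g0.
pose f a := if (a < g)%N then rho a%:Z else (s * rho (a - g)%:Z)%g.
rewrite (@card_dcosets_reps _ _ _ _ g.*2 f) ?odd_double // => [a|x|a b].
- by rewrite /f; case: ifP => _; rewrite ?groupM ?rho_G.
- case/dihP=> -[z ->].
    have [a lt_a ga] := modz_rep z g0; exists a; first by lia.
    by rewrite /f lt_a rho_dcoset_rr.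
  have [a lt_a] := modz_rep z g0; rewrite /g => /gcdn_dvdzP[x' [y' [kx [dy aE]]]].
  exists (a + g)%N; first by lia.
  rewrite /f ltnNge leq_addl /= addnK; apply/mem_dcosetP.
  exists (rho (- x')), (rho y'); rewrite !rho_rotg // rpredN; split=> //.
  by rewrite rho_srho srho_rho opprK -addrA -aE addrC subrK.
have sepE (u v : int) : ((s * rho u)%g \in (rotg k :* rho v * rotg d)%g) = false.
  apply/mem_dcosetP=> -[l [h [/(rotgP kn)[x _ ->] /(rotgP dn)[y _ ->] /eqP]]].
  by rewrite -!rhoD eq_sym rho_neq_srho.
rewrite /f; case: (ltnP a g) => ga; case: (ltnP b g) => gb lt_a lt_b; rewrite ?sepE //.
- by rewrite rho_dcoset_rr //; apply: dvdz_sub_small.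
- case/mem_dcosetP=> l [h [/(rotgP kn)[x _ ->] /(rotgP dn)[y _ ->] /eqP]].
  by rewrite rho_srho srho_rho rho_neq_srho.
case/mem_dcosetP=> l [h [/(rotgP kn)[x kx ->] /(rotgP dn)[y dy ->] /eqP]].
rewrite rho_srho srho_rho (inj_eq (mulgI s)) rho_eq => /(gcd_dvdn_z d kn) gD.
have gD' : (g %| (b - g)%:Z - (a - g)%:Z)%Z.
  have -> : (b - g)%:Z - (a - g)%:Z =
    y - x - ((a - g)%:Z - x + y - (b - g)%:Z) by ring.
  by rewrite !(rpredB _ gD, rpredB) // gcd_dvdz ?kx ?dy ?orbT.
have := dvdz_sub_small _ _ gD'; clear -ga gb lt_a lt_b; lia.
Qed.

(* With c = j - i, the double coset of r^a contains exactly the rotations r^b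
   with b congruent to a or to c - a mod g, so the double cosets are the orbits
   of an involution of Z/g; the shift h centres it at 0 or -1/2. *)
Lemma card_dcosets_dd k d i j : (k %| n)%N -> (d %| n)%N ->
  #|[set (dihg k i :* x * dihg d j)%g | x in G]| =
  if odd `|j - i|%N then uphalf (gcdn k d) else (gcdn k d)./2.+1.
Proof.
move=> kn dn; have g0 := gcdn_gt0_l d kn; set g := gcdn k d in g0 *.
set m := (X in _ = X).
pose h := ((j - i + 1) %/ 2)%Z.
apply: (@card_dcosets_reps _ _ _ _ _ (fun a => rho (a%:Z + h))) => [a|x Gx|a b].
- exact: rho_G.
- have [z xE] : exists z, (dihg k i :* x = dihg k i :* rho z)%g.
    have /dihP[[z ->]|[z ->]] := Gx; first by exists z.
    exists (z - i); apply/rcoset_eqP; rewrite mem_rcoset -rhoN !srho_rho srho_dihg //.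
    by rewrite addrAC subrr.
  rewrite xE; have [t lt_t gt] := modz_rep (z - h) g0.
  have [lt_tm|le_mt] := ltnP t m.
    by exists t => //; rewrite rho_dcoset_dd // -/g -addrA -[h - z]opprB gt.
  (* The index $t$ lies beyond the fundamental domain. The involution sends $t+h$ to $c-t-h$, that
     is, index $t$ to $c-2h-t$; adding $g$ brings it into range. *)
  pose a : int := (j - i) - h *+ 2 + g%:Z - t%:Z; exists `|a|%N.
    by move: le_mt lt_t; rewrite /a /m /h; clear; case: ifP; lia.
  have -> : `|a|%N%:Z = a.
    rewrite gez0_abs //; move: le_mt lt_t; rewrite /a /m /h; clear.
    by case: ifP; lia.
  rewrite rho_dcoset_dd // -/g; apply/orP; right.
  have -> : a + h + z - (j - i) = g%:Z - (t%:Z - (z - h)) by rewrite /a; ring.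
  by rewrite rpredB // dvdzz.
move=> lt_a lt_b; rewrite rho_dcoset_dd // -/g.
have -> : b%:Z + h - (a%:Z + h) = b%:Z - a%:Z by ring.
have [->//|ab] := eqVneq a b; case/orP=> [|gD].
  apply: dvdz_sub_small; move: lt_a lt_b ab g0; rewrite /m; clear.
    by case: ifP => _; lia.
  by case: ifP => _; lia.
move: gD lt_a lt_b ab g0; rewrite /m /h; clear; case: ifP => odd_c gD lt_a lt_b ab g0.
  have {}gD : (g %| b%:Z + a.+1%:Z)%Z by move: gD; congr (g %| _)%Z; lia.
  by have := dvdz_add_small _ _ gD; clear -lt_a lt_b ab; lia.
have {}gD : (g %| b%:Z + a%:Z)%Z by move: gD; congr (g %| _)%Z; lia.
by have := dvdz_add_small _ _ gD; clear -lt_a lt_b ab; lia.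
Qed.

End Dihedral.

(** * Marks of units for dihedral groups *)

Section Units.

Variables (gT : finGroupType) (G : {group gT}) (n : nat) (r s : gT).
Hypothesis dihG : dihedral_pair G n r s.

Let n_gt0 : (0 < n)%N. Proof. by case: dihG => _ []. Qed.
Let or : #[r]%g = n. Proof. by case: dihG => _ [_ []]. Qed.
Let oG : #|G| = n.*2. Proof. by case: dihG => _ [_ []]. Qed.
Let Gr : r \in G. Proof. by case: dihG => -[]. Qed.

Local Notation rho := (rho n r).
Local Notation rotg := (rotg r).
Local Notation dihg := (dihg n r s).
Local Notation ten H := (tensor_induction G (-1 : burnside H)).
Implicit Types u v : burnside G.

(* The number of double cosets of two dihedral subgroups <r^k, s r^i> and
   <r^d, s r^j>, for c = j - i and g = gcdn k d; see card_dcosets_dd. *)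
Definition refl_dcosets (c : int) (g : nat) : nat :=
  if odd `|c|%N then uphalf g else g./2.+1.

Lemma mark_ten_rr k d : (k %| n)%N -> (d %| n)%N -> mark (rotg k) (ten (rotg d)) = 1.
Proof.
move=> kn dn; rewrite mark_tensorN1 ?(rotg_G dihG) //.
by rewrite -signr_odd (odd_card_dcosets_rr dihG).
Qed.

Lemma mark_ten_dr k i d : (k %| n)%N -> (d %| n)%N ->
  mark (dihg k i) (ten (rotg d)) = (-1) ^+ gcdn k d.
Proof.
by move=> kn dn; rewrite mark_tensorN1 ?(dihg_G dihG) ?(card_dcosets_dr dihG).
Qed.

Lemma mark_ten_rd k d j : (k %| n)%N -> (d %| n)%N ->
  mark (rotg k) (ten (dihg d j)) = (-1) ^+ gcdn k d.
Proof.
by move=> kn dn; rewrite mark_tensorN1 ?(rotg_G dihG) ?(card_dcosets_rd dihG).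
Qed.

Lemma mark_ten_dd k i d j : (k %| n)%N -> (d %| n)%N ->
  mark (dihg k i) (ten (dihg d j)) = (-1) ^+ refl_dcosets (j - i) (gcdn k d).
Proof.
by move=> kn dn; rewrite mark_tensorN1 ?(dihg_G dihG) ?(card_dcosets_dd dihG).
Qed.

Lemma unit_sq u : u \is a GRing.unit -> u * u = 1.
Proof.
move=> Uu; apply: mark_inj => L sLG; rewrite markM // mark1 //.
by case: (mark_unit sLG Uu) => ->.
Qed.

Definition in_image u := exists a : burnside G, exp_map a = u.

Lemma in_image_unit u : in_image u -> u \is a GRing.unit.
Proof. by case=> a <-; apply: exp_map_unit. Qed.

Lemma in_imageM u v : in_image u -> in_image v -> in_image (u * v).
Proof. by case=> a <- [b <-]; exists (a + b); rewrite exp_mapD. Qed.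

Lemma in_image_ten (H : {group gT}) : H \subset G -> in_image (ten H).
Proof. by move=> sHG; exists (gset_class (coset_action G H)); apply: exp_map_coset. Qed.

Lemma dihg_mod k i j : (k %| n)%N -> (k %| j - i)%Z -> dihg k i = dihg k j.
Proof.
move=> kn kji; apply: (sub_dih_eq dihG) => [||z|z]; rewrite ?(dihg_G dihG) //.
  by rewrite !(rho_dihg dihG).
rewrite !(srho_dihg dihG) //; have -> : z - i = (z - j) + (j - i) by ring.
by rewrite rpredDr.
Qed.

Lemma mark_dihg_shift k i z u : mark (dihg k (i + z *+ 2)) u = mark (dihg k i) u.
Proof.
by rewrite -(dihgJ dihG) mark_conj ?(dihg_G dihG) // (rho_G dihG).
Qed.

(** Conjugation shifts $i$ by even numbers, and for odd $k$ the index $i$ may be replaced by the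
    even number $i+ki$. *)
Lemma mark_dihg_odd k i u : (k %| n)%N -> odd k ->
  mark (dihg k i) u = mark (dihg k 0) u.
Proof.
move=> kn odd_k; rewrite (@dihg_mod k i (i + k%:Z * i)) //; last first.
  by rewrite addrAC subrr add0r dvdz_mulr.
have [z zE] : exists z : int, i + k%:Z * i = 0 + z *+ 2.
  have kE : k%:Z = 1 + k./2%:Z * 2 by lia.
  by exists (i * (1 + k./2%:Z)); rewrite {1}kE; ring.
by rewrite zE mark_dihg_shift.
Qed.

Lemma mark_dihg_parity k i u :
  mark (dihg k i) u = mark (dihg k (if odd `|i|%N then 1 else 0)) u.
Proof.
have {1}-> : i = (if odd `|i|%N then 1 else 0) + (i %/ 2)%Z *+ 2.
  by case: ifP; lia.
by rewrite mark_dihg_shift.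
Qed.

Lemma rho_mul_in (A : {group gT}) z w : rho z \in A -> (z %| w)%Z -> rho w \in A.
Proof.
move=> Az /dvdzP[[q|q] ->]; first by rewrite mulrC (rhoM dihG) groupX.
by rewrite NegzE mulNr (rhoN dihG) groupV mulrC (rhoM dihG) groupX.
Qed.

Lemma rotg_sub k d : (k %| n)%N -> (d %| k)%N -> rotg k \subset rotg d.
Proof.
move=> kn dk; rewrite cycle_subG -(rho_nat dihG) (rho_rotg dihG) //.
exact: dvdn_trans kn.
Qed.

(** Identifies the subgroups that occur in [dvdz_sum_mark] for $N=R_k$ and a rotation $g$. *)
Lemma rotg_join k z : (k %| n)%N ->
  (rotg k <*> <[rho z]>)%G = rotg (gcdn k `|z|%N).
Proof.
move=> kn; have gn : (gcdn k `|z|%N %| n)%N by rewrite (dvdn_trans (dvdn_gcdl _ _)).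
apply/val_inj/eqP; rewrite eqEsubset; apply/andP; split.
  rewrite join_subG rotg_sub ?dvdn_gcdl //= cycle_subG (rho_rotg dihG) //.
  exact: dvdn_gcdr.
rewrite cycle_subG -(rho_nat dihG).
have [x [y [kx [zy gE]]]] : exists x y, (k %| x)%Z /\ (`|z|%N %| y)%Z /\
  (gcdn k `|z|%N)%:Z = x + y by apply: gcdn_dvdzP; apply: dvdzz.
rewrite gE (rhoD dihG) groupM //.
  by rewrite (subsetP (joing_subl _ _)) // (rho_rotg dihG).
apply: (@rho_mul_in _ z); first by rewrite (subsetP (joing_subr _ _)) // cycle_id.
exact: zy.
Qed.

Lemma sum_const_int (A : {set gT}) (F : gT -> int) c :
  {in A, forall x, F x = c} -> \sum_(x in A) F x = #|A|%:Z * c.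
Proof. by move=> AF; rewrite (eq_bigr _ AF) sumr_const -mulr_natl natz. Qed.

Lemma sum_splitI (A B : {set gT}) (F : gT -> int) : B \subset A ->
  \sum_(x in A) F x = \sum_(x in B) F x + \sum_(x in A :\: B) F x.
Proof. by move=> sBA; rewrite (big_setID B) /= (setIidPr sBA). Qed.

Lemma rotg1 : rotg 1 = <[r]>%G.
Proof. by apply: val_inj; rewrite /= expg1. Qed.

(** After cancelling $m$, $k>2$ divides a difference of two signs, which is at most 2 in absolute
    value. *)
Lemma sign_congr (m k : nat) (x y : int) : (0 < m)%N -> (2 < k)%N ->
  x = 1 \/ x = -1 -> y = 1 \/ y = -1 ->
  ((m * k)%N %| m%:Z * (x - y))%Z -> x = y.
Proof.
move=> m0 k2 x1 y1; rewrite PoszM dvdz_mul2l ?eqz_nat -?lt0n // => /dvdz_small xy.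
apply/eqP; rewrite -subr_eq0; apply/eqP/xy.
by case: x1 => ->; case: y1 => ->; lia.
Qed.

(* Apply the congruence of dvdz_sum_mark to <r^k> inside <r>, inductively on k:
   it leaves k %| mark <r^k> u - c with c a sign, and k > 2 forces equality. *)
Lemma mark_rotg_parity k u : u \is a GRing.unit -> (k %| n)%N ->
  mark (rotg k) u = mark (rotg (if odd k then 1 else 2)) u.
Proof.
move=> Uu; elim/ltn_ind: k => k IHk kn.
have k_gt0 := dvdn_gt0 n_gt0 kn.
have f_pm d : mark (rotg d) u = 1 \/ mark (rotg d) u = -1.
  by apply: mark_unit => //; apply: (rotg_G dihG).
have [k_le2|k_gt2] := leqP k 2; first by congr mark; case: k k_le2 k_gt0 {IHk kn} => [|[|[]]].
have := @dvdz_sum_mark _ G (rotg k) <[r]>%G u (sub_rG dihG).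
rewrite -{1}rotg1 rotg_sub // => /(_ isT).
rewrite (subset_trans (sub_rG dihG) (rotg_norm dihG k)) => /(_ isT).
rewrite -orderE or -[<[r]>%G]rotg1.
have sk1 : rotg k \subset rotg 1 by apply: rotg_sub.
set F := fun x => mark (rotg k <*> <[x]>) u.
have FE z : F (rho z) = mark (rotg (gcdn k `|z|%N)) u.
  by rewrite -rotg_join.
have Fk : \sum_(x in rotg k) F x = #|rotg k|%:Z * mark (rotg k) u.
  apply: sum_const_int => x /(rotgP dihG kn)[z kz ->].
  by rewrite FE; congr (mark (rotg _) u); apply/gcdn_idPl.
(* Outside $R_k$ the gcd is a proper divisor of $k$, so the induction hypothesis applies. *)
have Fprop z : ~~ (k %| z)%Z ->
    F (rho z) = mark (rotg (if odd (gcdn k `|z|%N) then 1 else 2)) u.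
  move=> nkz; rewrite FE; apply: IHk; last by rewrite (dvdn_trans (dvdn_gcdl _ _)).
  rewrite ltn_neqAle dvdn_leq ?dvdn_gcdl // andbT; apply: contraNneq nkz => gk.
  by rewrite -{1}gk; apply: dvdn_gcdr.
rewrite (sum_splitI F sk1) Fk.
have ck : #|rotg k| = (n %/ k)%N by apply: (card_rotg dihG).
have c1 : #|rotg 1| = n by rewrite (card_rotg dihG) ?divn1.
case: ifP => odd_k.
  (* With $x$, $y$ the marks at $R_k$, $R_1$, the sum is $(n/k)(x-y)+ny$. *)
  rewrite (@sum_const_int _ _ (mark (rotg 1) u)); last first.
    move=> x /setDP[/(rotgP dihG (dvd1n n))[z _ ->]].
    rewrite (rho_rotg dihG) // => /Fprop ->.
    suff -> : odd (gcdn k `|z|%N) by [].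
    exact: dvdn_odd (dvdn_gcdl _ _) odd_k.
  rewrite cardsD (setIidPr sk1) ck c1 => n_sum.
  apply: (@sign_congr (n %/ k) k) => //; first by rewrite divn_gt0 // dvdn_leq.
  rewrite divnK // -[X in (_ %| X)%Z](addrK (n%:Z * mark (rotg 1) u)).
  rewrite rpredB ?dvdz_mulr //; move: n_sum; congr (_ %| _)%Z.
  by rewrite -subzn ?leq_div //; ring.
have n2 : (2 %| n)%N by apply: dvdn_trans kn; rewrite dvdn2 odd_k.
have sk2 : rotg k \subset rotg 2 by apply: rotg_sub; rewrite // dvdn2 odd_k.
have s21 : rotg 2 \subset rotg 1 by apply: rotg_sub.
have c2 : #|rotg 2| = n./2 by rewrite (card_rotg dihG) // divn2.
have sk21 : rotg 2 :\: rotg k \subset rotg 1 :\: rotg k by apply: setSD.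
rewrite (sum_splitI F sk21) (@sum_const_int (rotg 2 :\: _) _ (mark (rotg 2) u)); last first.
  move=> x /setDP[/(rotgP dihG n2)[z z2 ->]].
  rewrite (rho_rotg dihG) // => /Fprop ->.
  suff -> : odd (gcdn k `|z|%N) = false by [].
  by apply: negbTE; rewrite -dvdn2 dvdn_gcd dvdn2 odd_k.
rewrite (@sum_const_int _ _ (mark (rotg 1) u)); last first.
  move=> x /setDP[/setDP[/(rotgP dihG (dvd1n n))[z _ ->]]].
  rewrite inE !(rho_rotg dihG) // => nkz; rewrite nkz /= => nz2.
  rewrite Fprop //; suff -> : odd (gcdn k `|z|%N) by [].
  by apply: contraNT nz2; rewrite -dvdn2 dvdn_gcd => /andP[].
rewrite !cardsD (setIidPr sk1) (setIidPr sk2) (setIidPr sk21) cardsD (setIidPr sk2).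
rewrite ck c1 c2 => n_sum.
apply: (@sign_congr (n %/ k) k) => //; first by rewrite divn_gt0 // dvdn_leq.
(* A sum of two signs is even, so this part vanishes modulo $n$ and leaves $n/k$ times the
   difference of the marks at $R_k$ and $R_2$. *)
have h2 : (n%:Z %| (n./2)%:Z * (mark (rotg 1) u + mark (rotg 2) u))%Z.
  have nE : n%:Z = n./2%:Z * 2 by lia.
  rewrite {1}nE dvdz_mul //.
  by case: (f_pm 1%N) => ->; case: (f_pm 2%N) => ->.
rewrite divnK // -[X in (_ %| X)%Z](addrK ((n./2)%:Z * (mark (rotg 1) u + mark (rotg 2) u))).
rewrite rpredB //; move: n_sum; congr (_ %| _)%Z.
have le1 : (n %/ k <= n./2)%N by rewrite -divn2 leq_div2l // ltnW.
have -> : (n - n %/ k - (n./2 - n %/ k))%:Z = (n./2)%:Z by lia.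
by rewrite -subzn //; ring.
Qed.

(** The congruence for $N=R_k$ inside $G$: rotations and reflections with even or odd exponent form
    four classes of $n/2$ elements, each with constant mark, and $2n$ divides $n/2$ times the sum of
    the four marks. *)
Lemma mark_dihg_even k u : u \is a GRing.unit -> (k %| n)%N -> ~~ odd k ->
  (4 %| mark (rotg 1) u + mark (rotg 2) u +
        (mark (dihg k 0) u + mark (dihg k 1) u))%Z.
Proof.
move=> Uu kn odd_k.
have n2 : (2 %| n)%N by apply: dvdn_trans kn; rewrite dvdn2.
have := @dvdz_sum_mark _ G (rotg k) G u (subxx _) (rotg_G dihG k) (rotg_norm dihG k).
set F := fun x => mark (rotg k <*> <[x]>) u.
have s1G : rotg 1 \subset G by apply: (rotg_G dihG).
have s21 : rotg 2 \subset rotg 1 by apply: rotg_sub.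
have c1 : #|rotg 1| = n by rewrite (card_rotg dihG) ?divn1.
have c2 : #|rotg 2| = n./2 by rewrite (card_rotg dihG) // divn2.
have FE z : F (rho z) = mark (rotg (if odd `|z|%N then 1 else 2)) u.
  have -> : F (rho z) = mark (rotg (gcdn k `|z|%N)) u by rewrite -rotg_join.
  rewrite mark_rotg_parity // ?(dvdn_trans (dvdn_gcdl _ _)) //.
  congr (mark (rotg (if _ then _ else _)) u).
  by apply: negb_inj; rewrite -!dvdn2 dvdn_gcd dvdn2 odd_k.
have FsE z : F (s * rho z)%g = mark (dihg k (if odd `|z|%N then 1 else 0)) u.
  exact: mark_dihg_parity.
(* Intersecting with [dihg 2 0] selects the reflections with even exponent. *)
have cD : #|(G :\: rotg 1) :&: dihg 2 0| = n./2.
  rewrite -c2 -(card_rcoset (rotg 2) (s * rho 0)%g); apply: eq_card => x.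
  rewrite inE [in X in X && _]inE.
  case Gx: (x \in G); last first.
    rewrite andbF; apply/esym; apply: contraFF Gx; apply: subsetP.
    rewrite mul_subG ?(rotg_G dihG) // sub1set groupM ?(rho_G dihG) //.
    by case: dihG => -[].
  rewrite mem_rcoset (srhoV dihG); case/(dihP dihG): Gx => -[z ->].
    by rewrite (rho_rotg dihG) // dvd1z (rho_srho dihG) (srho_rotg dihG).
  rewrite (srho_rotg dihG) (srho_dihg dihG) // (srhoD dihG) (rho_rotg dihG) //=.
  by rewrite subr0 sub0r rpredN.
have sA : (G :\: rotg 1) :&: dihg 2 0 \subset G :\: rotg 1 by apply: subsetIl.
rewrite (sum_splitI F s1G) (sum_splitI F s21) (sum_splitI F sA) oG.
rewrite (@sum_const_int (rotg 2) _ (mark (rotg 2) u)); last first.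
  move=> x /(rotgP dihG n2)[z z2 ->]; rewrite FE.
  by case: ifP => //; rewrite -[odd _]negbK -dvdn2 (z2 : (2 %| `|z|)%N).
rewrite (@sum_const_int (rotg 1 :\: _) _ (mark (rotg 1) u)); last first.
  move=> x /setDP[/(rotgP dihG (dvd1n n))[z _ ->]]; rewrite (rho_rotg dihG) // => z2.
  rewrite FE; case: ifP => //; rewrite -[odd _]negbK -dvdn2.
  by rewrite (negbTE (z2 : ~~ (2 %| `|z|)%N)).
rewrite (@sum_const_int (_ :&: _) _ (mark (dihg k 0) u)); last first.
  move=> x /setIP[/setDP[Gx]]; case/(dihP dihG): Gx => -[z ->].
    by rewrite (rho_rotg dihG) // dvd1z.
  move=> _; rewrite (srho_dihg dihG) // subr0 FsE => z2.
  by case: ifP => //; rewrite -[odd _]negbK -dvdn2 (z2 : (2 %| `|z|)%N).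
rewrite (@sum_const_int (_ :\: _) _ (mark (dihg k 1) u)); last first.
  move=> x /setDP[/setDP[Gx]]; case/(dihP dihG): (Gx) => -[z xE]; rewrite xE in Gx *.
    by rewrite (rho_rotg dihG) // dvd1z.
  move=> nrx; rewrite !inE nrx Gx /= -[x in x \in _]/(s * rho z)%g.
  have -> : ((s * rho z)%g \in rotg 2 <*> <[s * rho 0]>) = (2 %| z - 0)%Z.
    exact: (srho_dihg dihG).
  rewrite subr0 FsE => z2.
  by case: ifP => //; rewrite -[odd _]negbK -dvdn2 (negbTE (z2 : ~~ (2 %| `|z|)%N)).
rewrite !cardsD (setIidPr s21) (setIidPr s1G) (setIidPr sA) cD.
rewrite oG c1 c2.
have -> : (n.*2 - n - n./2 = n./2)%N by lia.
have -> : (n - n./2 = n./2)%N by lia.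
have -> : n.*2%:Z = n./2%:Z * 4 by lia.
rewrite -!mulrDr dvdz_mul2l ?eqz_nat; last by lia.
by rewrite [mark (rotg 2) u + _]addrC.
Qed.

(** These marks characterise the unit $u_d$. *)
Definition sign_on_multiples d u :=
  (forall k, (k %| n)%N -> mark (rotg k) u = 1) /\
  (forall k i, (k %| n)%N -> mark (dihg k i) u = (-1) ^+ (d %| k)%N).

Lemma burnside_dih_inj u v :
  (forall k, (k %| n)%N -> mark (rotg k) u = mark (rotg k) v) ->
  (forall k i, (k %| n)%N -> mark (dihg k i) u = mark (dihg k i) v) -> u = v.
Proof.
move=> eq_rot eq_dih; apply: mark_inj => L /(subgroup_dih dihG)[k [kn]].
by case=> [->|[i ->]]; [apply: eq_rot | apply: eq_dih].
Qed.

(** * Generation of the unit group *)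

Section Generation.

Hypothesis sign_in_image : forall d, (d %| n)%N ->
  exists2 v, in_image v & sign_on_multiples d v.

Lemma in_image1 : in_image 1.
Proof.
have [v v_im _] := sign_in_image (dvd1n n).
by rewrite -(unit_sq (in_image_unit v_im)); apply: in_imageM.
Qed.

Let dih_const u := forall k i, (k %| n)%N -> mark (dihg k i) u = mark (dihg k 0) u.

(** For even $k$, [mark_dihg_even] makes 4 divide 2 plus the marks at $L_{k,0}$ and $L_{k,1}$, so
    these agree. Only the marks at the $L_{k,0}$ remain, and on them the $u_d$ form a triangular
    system. *)
Lemma in_image_of_rot1 u : u \is a GRing.unit ->
  (forall k, (k %| n)%N -> mark (rotg k) u = 1) -> in_image u.
Proof.
move=> Uu rot_u.
have const_u : dih_const u.
  move=> k i kn; have [odd_k|odd_k] := boolP (odd k); first exact: mark_dihg_odd.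
  rewrite mark_dihg_parity; case: ifP => // _.
  have n2 : (2 %| n)%N by apply: dvdn_trans kn; rewrite dvdn2.
  have := mark_dihg_even Uu kn odd_k; rewrite !rot_u ?dvd1n //.
  have [] := mark_unit (dihg_G dihG k 0) Uu => ->;
  by have [] := mark_unit (dihg_G dihG k 1) Uu => ->.
have [v v_im [rot_v const_v eq_uv]] : exists2 v, in_image v &
  [/\ forall k, (k %| n)%N -> mark (rotg k) v = 1, dih_const v &
   forall k, (k %| n)%N -> (k < n.+1)%N -> mark (dihg k 0) v = mark (dihg k 0) u].
  elim: n.+1 => [|m [v v_im [rot_v const_v eq_uv]]].
    exists 1; first exact: in_image1.
    by split=> // [k _|k i _]; rewrite !mark1 ?(rotg_G dihG) ?(dihg_G dihG).
  have Uv := in_image_unit v_im.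
  have [[mn ne_m]|done_m] := pselect ((m %| n)%N /\ mark (dihg m 0) v != mark (dihg m 0) u);
      last first.
    exists v => //; split=> // k kn; rewrite ltnS leq_eqVlt => /orP[/eqP km|]; last exact: eq_uv.
    by apply/eqP/negP => /negP ne; case: done_m; rewrite -km.
  (* Multiplying by $u_m$ corrects the sign at $m$ and changes nothing at smaller $k$. *)
  have [w w_im [rot_w dih_w]] := sign_in_image mn.
  exists (v * w); first exact: in_imageM.
  split=> [k kn|k i kn|k kn].
  - by rewrite markM ?(rotg_G dihG) // rot_v ?rot_w.
  - by rewrite !markM ?(dihg_G dihG) // !dih_w // const_v.
  rewrite ltnS => le_km; rewrite markM ?(dihg_G dihG) // dih_w //.
  move: le_km; rewrite leq_eqVlt => /orP[/eqP ->|lt_km].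
    rewrite dvdnn; have [] := mark_unit (dihg_G dihG m 0) Uu;
    by have [] := mark_unit (dihg_G dihG m 0) Uv; move: ne_m => /[swap] -> /[swap] ->.
  by rewrite gtnNdvd ?(dvdn_gt0 n_gt0) // mulr1; apply: eq_uv.
suff -> : u = v by [].
apply: burnside_dih_inj => [k kn|k i kn]; first by rewrite rot_u ?rot_v.
by rewrite const_u // const_v // eq_uv // ltnS dvdn_leq.
Qed.

(** It is enough to match the marks at rotation subgroups by an element of the image; by
    [mark_rotg_parity] only $R_1$ and, for even $n$, $R_2$ count. *)
Lemma in_image_all u : u \is a GRing.unit -> in_image u.
Proof.
move=> Uu.
suff [v v_im rot_uv] : exists2 v, in_image v &
    forall k, (k %| n)%N -> mark (rotg k) u * mark (rotg k) v = 1.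
  rewrite -[u]mulr1 -(unit_sq (in_image_unit v_im)) mulrA; apply: in_imageM => //.
  apply: in_image_of_rot1 => [|k kn]; first by rewrite unitrM Uu in_image_unit.
  by rewrite markM ?(rotg_G dihG) // rot_uv.
have red v : v \is a GRing.unit ->
    mark (rotg 1) u * mark (rotg 1) v = 1 ->
    ((2 %| n)%N -> mark (rotg 2) u * mark (rotg 2) v = 1) ->
    forall k, (k %| n)%N -> mark (rotg k) u * mark (rotg k) v = 1.
  move=> Uv uv1 uv2 k kn; rewrite (mark_rotg_parity Uu) // (mark_rotg_parity Uv) //.
  by case: ifP => // /negbT odd_k; apply: uv2; apply: dvdn_trans kn; rewrite dvdn2.
(* For even $n$ the marks at $(R_1,R_2)$ are $(-1,-1)$ for $L_{1,0}=G$ and $(-1,1)$ for $L_{2,0}$;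
   together these generate all sign patterns. *)
have e1_im : in_image (ten (dihg 1 0)) := in_image_ten (dihg_G dihG 1 0).
have e2_im : in_image (ten (dihg 2 0)) := in_image_ten (dihg_G dihG 2 0).
have Uim v : in_image v -> v \is a GRing.unit := @in_image_unit v.
have e11 : mark (rotg 1) (ten (dihg 1 0)) = -1 by rewrite mark_ten_rd.
have e12 : (2 %| n)%N -> mark (rotg 2) (ten (dihg 1 0)) = -1 by move=> ?; rewrite mark_ten_rd.
have e21 : (2 %| n)%N -> mark (rotg 1) (ten (dihg 2 0)) = -1 by move=> ?; rewrite mark_ten_rd.
have e22 : (2 %| n)%N -> mark (rotg 2) (ten (dihg 2 0)) = 1 by move=> ?; rewrite mark_ten_rd.
have e32 : in_image (ten (dihg 1 0) * ten (dihg 2 0)) by apply: in_imageM.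
have im1 := in_image1.
have m1 k : mark (rotg k) (1 : burnside G) = 1 by rewrite mark1 ?(rotg_G dihG).
have mM k v w : mark (rotg k) (v * w : burnside G) = mark (rotg k) v * mark (rotg k) w.
  by rewrite markM ?(rotg_G dihG).
have [n2|n2] := boolP (2 %| n)%N; last first.
  have [u1|u1] := mark_unit (rotg_G dihG 1) Uu.
    by exists 1 => //; apply: red; rewrite ?unitr1 ?u1 ?m1 ?(negbTE n2).
  by exists (ten (dihg 1 0)) => //; apply: red; rewrite ?Uim ?u1 ?e11 ?(negbTE n2).
have [] := mark_unit (rotg_G dihG 1) Uu; have [] := mark_unit (rotg_G dihG 2) Uu => u2 u1.
- by exists 1 => //; apply: red; rewrite ?unitr1 ?u1 ?u2 ?m1.
- exists (ten (dihg 1 0) * ten (dihg 2 0)) => //; apply: red;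
    by rewrite ?Uim ?u1 ?u2 ?mM ?e11 ?e12 ?e21 ?e22.
- by exists (ten (dihg 2 0)) => //; apply: red; rewrite ?Uim ?u1 ?u2 ?e21 ?e22.
by exists (ten (dihg 1 0)) => //; apply: red; rewrite ?Uim ?u1 ?u2 ?e11 ?e12.
Qed.

End Generation.

End Units.

(** * Parities of gcds and double coset numbers *)

Lemma gcdn_prime_exp p j k : prime p -> ~~ (p ^ j.+1 %| k)%N ->
  gcdn k (p ^ j.+1) = gcdn k (p ^ j).
Proof.
move=> p_pr npk; apply/eqP; rewrite eqn_dvd !dvdn_gcd !dvdn_gcdl /=.
rewrite (dvdn_trans (dvdn_gcdr k (p ^ j))) ?dvdn_exp2l // andbT.
have /dvdn_pfactor [//|m le_m gE] := dvdn_gcdr k (p ^ j.+1).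
move: le_m; rewrite leq_eqVlt => /orP[/eqP mE|lt_m]; last by rewrite gE dvdn_exp2l.
by case/negP: npk; rewrite -mE -gE dvdn_gcdl.
Qed.

Lemma gcdn_double k q : odd q -> gcdn k q.*2 = if odd k then gcdn k q else (gcdn k q).*2.
Proof.
move=> odd_q; rewrite -!mul2n; case: ifP => odd_k.
  by rewrite Gauss_gcdr // coprimen2.
have -> : k = (2 * k./2)%N by lia.
by rewrite -muln_gcdr [gcdn (2 * _) q]gcdnC Gauss_gcdr ?coprimen2 // gcdnC.
Qed.

(** At odd $w$ both branches of [refl_dcosets] equal $(w+1)/2$, so the sum is $w(p+1)/2+1$ with
    $4\mid p+1$. *)
Lemma refl_dcosets_mul3mod4 c p w : odd w -> p = 3 %[mod 4] ->
  odd (refl_dcosets c (p * w) + refl_dcosets c w).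
Proof.
move=> odd_w p3; have [t ->] : exists t, p = (4 * t + 3)%N.
  by exists (p %/ 4)%N; lia.
rewrite /refl_dcosets mulnDl -mulnA; move: (t * w)%N => v.
by case: ifP => _; lia.
Qed.

(** The sum is $q+w$ or $q+w+2$. *)
Lemma refl_dcosets_double c q w : odd q -> odd w ->
  odd (refl_dcosets c q.*2 + refl_dcosets c w.*2) = false.
Proof. by move=> odd_q odd_w; rewrite /refl_dcosets; case: ifP => _; lia. Qed.

Lemma signr_addb (a b : nat) (c : bool) : odd (a + b) = c ->
  (-1) ^+ a * (-1) ^+ b = (-1) ^+ c :> int.
Proof. by move=> <-; rewrite -exprD signr_odd. Qed.

(** * The units $u_d$ *)

Section SignUnits.

Variables (gT : finGroupType) (G : {group gT}) (n : nat) (r s : gT).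
Hypothesis dihG : dihedral_pair G n r s.

Let n_gt0 : (0 < n)%N. Proof. by case: dihG => _ []. Qed.
Let oG : #|G| = n.*2. Proof. by case: dihG => _ [_ []]. Qed.

Local Notation rho := (rho n r).
Local Notation rotg := (rotg r).
Local Notation dihg := (dihg n r s).
Local Notation ten H := (tensor_induction G (-1 : burnside H)).
Local Notation sign_on_multiples := (@sign_on_multiples gT G n r s).
Implicit Types u v : burnside G.

Lemma sign_on_multiples1 : sign_on_multiples 1 (ten (rotg 1)).
Proof.
split=> [k kn|k i kn]; first by rewrite (mark_ten_rr dihG).
by rewrite (mark_ten_dr dihG) // gcdn1 dvd1n.
Qed.

Lemma sign_on_multiples2 : (2 %| n)%N ->
  sign_on_multiples 2 (ten (rotg 1) * ten (rotg 2)).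
Proof.
move=> n2; split=> [k kn|k i kn].
  by rewrite markM ?(rotg_G dihG) // !(mark_ten_rr dihG).
rewrite markM ?(dihg_G dihG) // !(mark_ten_dr dihG) // gcdn1; apply: signr_addb.
rewrite dvdn2; case: (boolP (odd k)) => odd_k.
  by have /eqP -> : coprime k 2 by rewrite coprimen2.
by have /gcdn_idPr -> : (2 %| k)%N by rewrite dvdn2.
Qed.

(** By [gcdn_prime_exp] the two factors have equal marks, hence cancel, unless $p^{j+1}\mid k$.
    There the gcds are $p^{j+1}$ and $p^j$: they have the same parity, while the double coset
    numbers at dihedral subgroups have odd sum. *)
Lemma sign_on_multiples_pfactor p j : prime p ->
  (p = 2%N /\ j = 1%N) \/ p = 3 %[mod 4] -> (p ^ j.+1 %| n)%N ->
  sign_on_multiples (p ^ j.+1) (ten (dihg (p ^ j.+1) 0) * ten (dihg (p ^ j) 0)).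
Proof.
move=> p_pr p_cond Pn.
have P'P : (p ^ j %| p ^ j.+1)%N by rewrite dvdn_exp2l.
have P'n := dvdn_trans P'P Pn.
have PE k : (p ^ j.+1 %| k)%N ->
    gcdn k (p ^ j.+1) = (p ^ j.+1)%N /\ gcdn k (p ^ j) = (p ^ j)%N.
  by move=> Pk; split; apply/gcdn_idPr; rewrite // (dvdn_trans P'P).
split=> [k kn|k i kn].
  rewrite markM ?(rotg_G dihG) // !(mark_ten_rd dihG) //.
  apply: (@signr_addb _ _ false).
  have [/PE[-> ->]|nPk] := boolP (p ^ j.+1 %| k)%N; last first.
    by rewrite gcdn_prime_exp // oddD addbb.
  case: p_cond => [[-> ->] //|p3].
  have odd_p : odd p by lia.
  by rewrite oddD !oddX odd_p !orbT.
rewrite markM ?(dihg_G dihG) // !(mark_ten_dd dihG) //; apply: signr_addb.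
have [/PE[-> ->]|nPk] := boolP (p ^ j.+1 %| k)%N; last first.
  by rewrite gcdn_prime_exp // oddD addbb.
case: p_cond => [[-> ->]|p3]; first by rewrite /refl_dcosets; case: ifP.
have odd_p : odd p by lia.
by rewrite expnS refl_dcosets_mul3mod4 // oddX odd_p orbT.
Qed.

(** At $L_{k,i}$ with $k$ odd, the second pair has the marks of the first and cancels it; with $k$
    even it has mark 1, which leaves the sign of $u_{p^{j+1}}$. *)
Lemma sign_on_multiples_double_pfactor p j : prime p -> p = 3 %[mod 4] ->
    ((p ^ j.+1).*2 %| n)%N ->
  sign_on_multiples (p ^ j.+1).*2
    (ten (dihg (p ^ j.+1) 0) * ten (dihg (p ^ j) 0) *
     (ten (dihg (p ^ j.+1).*2 0) * ten (dihg (p ^ j).*2 0))).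
Proof.
move=> p_pr p3 P2n.
have odd_p : odd p by lia.
have odd_pX m : odd (p ^ m) by rewrite oddX odd_p orbT.
have Pn : (p ^ j.+1 %| n)%N by apply: dvdn_trans P2n; rewrite -mul2n dvdn_mull.
have P'2n : ((p ^ j).*2 %| n)%N.
  by apply: dvdn_trans P2n; rewrite -!mul2n dvdn_mul // dvdn_exp2l.
have [rotAB dihAB] := sign_on_multiples_pfactor p_pr (or_intror p3) Pn.
set A := ten _ * ten _ in rotAB dihAB *.
have P2k k : ((p ^ j.+1).*2 %| k)%N = (p ^ j.+1 %| k)%N && ~~ odd k.
  by rewrite -mul2n Gauss_dvd ?coprime2n // dvdn2 andbC.
split=> [k kn|k i kn].
  rewrite markM ?(rotg_G dihG) // rotAB // mul1r.
  rewrite markM ?(rotg_G dihG) // !(mark_ten_rd dihG) //.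
  apply: (@signr_addb _ _ false); rewrite !gcdn_double //.
  case: ifP => odd_k; last by rewrite oddD !odd_double.
  by rewrite oddD !(dvdn_odd (dvdn_gcdl k _)).
rewrite markM ?(dihg_G dihG) // dihAB // P2k.
rewrite markM ?(dihg_G dihG) // !(mark_ten_dd dihG) // !gcdn_double //.
case: ifP => odd_k; last first.
  rewrite (@signr_addb _ _ false) ?mulr1 ?andbT //.
  by apply: refl_dcosets_double; apply: (dvdn_odd (dvdn_gcdr k _)).
have P'n : (p ^ j %| n)%N by apply: dvdn_trans P'2n; rewrite -mul2n dvdn_mull.
rewrite -!(mark_ten_dd dihG) // -markM ?(dihg_G dihG) // dihAB //.
by rewrite andbF; case: (_ %| _)%N.
Qed.

Lemma in_afix_coset (L H : {group gT}) (A : {A : {set gT} | A \in rcosets H G}) x :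
  L \subset G -> x \in G -> val A = (H :* x)%g ->
  (A \in 'Fix_(coset_action G H)(L)) = (L \subset H :^ x)%g.
Proof.
move=> sLG Gx AE; rewrite afixE inE; apply/forall_inP/subsetP=> fix_A l Ll.
  have /eqP/(congr1 val) := fix_A l Ll.
  rewrite val_coset_action ?(subsetP sLG) // AE -rcosetM => /rcoset_eqP.
  by rewrite mem_rcoset mem_conjg conjgE invgK -mulgA.
apply/eqP/val_inj; rewrite val_coset_action ?(subsetP sLG) // AE -rcosetM.
apply/rcoset_eqP; have := fix_A l Ll.
by rewrite mem_rcoset mem_conjg conjgE invgK -mulgA.
Qed.

Lemma mark_coset_normal (L H : {group gT}) : L \subset G -> H \subset G ->
  G \subset 'N(H) -> mark L (gset_class (coset_action G H)) =
  ((L \subset H) * #|G : H|)%N.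
Proof.
move=> sLG sHG nHG; rewrite mark_gset_class //; congr Posz.
have in_fix A : (A \in 'Fix_(coset_action G H)(L)) = (L \subset H).
  have /rcosetsP[x Gx AE] := valP A.
  by rewrite (in_afix_coset sLG Gx AE) (normP (subsetP nHG x Gx)).
case: (L \subset H) in_fix => in_fix; last by rewrite mul0n; apply: eq_card0.
by rewrite mul1n -[RHS]card_sig; apply: eq_card => A; rewrite in_fix.
Qed.

Lemma mark_coset_reps (L H : {group gT}) m (f : nat -> gT) :
    L \subset G -> (forall a, f a \in G) ->
    (forall x, x \in G -> exists2 a, (a < m)%N & f a \in (H :* x)%g) ->
    (forall a b, (a < m)%N -> (b < m)%N -> f b \in (H :* f a)%g -> a = b) ->
  mark L (gset_class (coset_action G H)) = (\sum_(a < m) (L \subset H :^ f a))%N.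
Proof.
move=> sLG Gf f_ex f_inj; rewrite mark_gset_class //; congr Posz.
have rf (a : 'I_m) : (H :* f a)%g \in rcosets H G by apply/rcosetsP; exists (f a).
pose F (a : 'I_m) := exist (fun A => A \in rcosets H G) _ (rf a).
have F_inj : injective F.
  move=> a b /(congr1 val) eqF; have {}eqF : (H :* f a = H :* f b)%g := eqF.
  by apply/val_inj/f_inj => //=; rewrite eqF; apply: rcoset_refl.
transitivity #|F @: [set a : 'I_m | L \subset H :^ f a]%g|; last first.
  rewrite card_imset // -sum1_card big_mkcond.
  by apply: eq_bigr => a _; rewrite inE; case: (_ \subset _).
apply: eq_card => A; apply/idP/imsetP=> [fixA|[a + ->]]; last first.
  by rewrite inE => La; rewrite (in_afix_coset sLG (Gf a)).
have /rcosetsP[x Gx AE] := valP A; have [a lt_am fa] := f_ex x Gx.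
have AE' : val A = (H :* f a)%g by rewrite AE; apply/rcoset_eqP; rewrite rcoset_sym.
exists (Ordinal lt_am); last exact: val_inj.
by rewrite inE -(in_afix_coset sLG (Gf a) AE').
Qed.

Lemma dihgS k d i j : (k %| n)%N -> (d %| n)%N ->
  (dihg k i \subset dihg d j) = (d %| k)%N && (d %| i - j)%Z.
Proof.
move=> kn dn; rewrite join_subG !cycle_subG -(rho_nat dihG).
by rewrite (rho_dihg dihG) // (srho_dihg dihG).
Qed.

Lemma rotgS_dihg k d j : (d %| n)%N -> (rotg k \subset dihg d j) = (d %| k)%N.
Proof. by move=> dn; rewrite cycle_subG -(rho_nat dihG) (rho_dihg dihG). Qed.

(** The $r^a$ with $a<d$ represent the right cosets of $L_{d,j}$, and conjugation by $r^a$ adds $2a$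
    to $j$. *)
Lemma mark_coset_dihg (L : {group gT}) d j : L \subset G -> (d %| n)%N ->
  mark L (gset_class (coset_action G (dihg d j))) =
  (\sum_(a < d) (L \subset dihg d (j + a%:Z *+ 2)%R))%N.
Proof.
move=> sLG dn; have d0 := dvdn_gt0 n_gt0 dn.
rewrite (@mark_coset_reps _ _ d (fun a => rho a)) // => [|a|x|a b].
- by under eq_bigr do rewrite (dihgJ dihG).
- exact: (rho_G dihG).
- case/(dihP dihG)=> -[z ->].
    have [a lt_a da] := modz_rep z d0; exists a => //.
    by rewrite mem_rcoset -(rhoN dihG) -(rhoD dihG) (rho_dihg dihG).
  have [a lt_a da] := modz_rep (z - j) d0; exists a => //.
  rewrite mem_rcoset (srhoV dihG) (rho_srho dihG) (srho_dihg dihG) //.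
  by move: da; rewrite -rpredN; congr (_ %| _)%Z; ring.
move=> lt_a lt_b; rewrite mem_rcoset -(rhoN dihG) -(rhoD dihG) (rho_dihg dihG) //.
exact: dvdz_sub_small.
Qed.

Lemma sum_even_odd (F : nat -> nat) d :
  (\sum_(a < d) F a.*2 + \sum_(a < d) F a.*2.+1 = \sum_(t < d.*2) F t)%N.
Proof.
elim: d => [|d IHd]; first by rewrite !big_ord0.
by rewrite doubleS !big_ord_recr /= -IHd addnACA addnA.
Qed.

Lemma count_residue (d : nat) (i : int) : (0 < d)%N -> (\sum_(t < d) (d %| (i - t%:Z)%R)%Z = 1)%N.
Proof.
move=> d0; have [t0 lt_t0 dt0] := modz_rep i d0.
rewrite (bigD1 (Ordinal lt_t0)) //= -rpredN opprB dt0 big1 // => t ne_t.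
apply/eqP; rewrite eqb0; apply: contraNN ne_t => dt; apply/eqP/val_inj => /=.
apply: (@dvdz_sub_small d) => //; rewrite ?ltn_ord //.
have -> : t0%:Z - t%:Z = (t0%:Z - i) + (i - t%:Z) by ring.
by rewrite rpredD.
Qed.

(* 1 - [G/<r^d, s>] - [G/<r^d, s r>] + [G/<r^d>]; for odd d the two dihedral
   subgroups are conjugate. *)
Lemma sign_on_multiples_exists d : (d %| n)%N ->
  exists2 u, u \is a GRing.unit & sign_on_multiples d u.
Proof.
move=> dn; have d0 := dvdn_gt0 n_gt0 dn.
pose cos (H : {group gT}) : burnside G := gset_class (coset_action G H).
pose u := 1 - (cos (dihg d 0) + cos (dihg d 1) - cos (rotg d)).
have markE (L : {group gT}) : L \subset G -> mark L u =
    1 - (mark L (cos (dihg d 0)) + mark L (cos (dihg d 1)) - mark L (cos (rotg d))).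
  by move=> sLG; rewrite /u !(markD, markN, mark1).
have index_d : #|G : rotg d| = d.*2.
  rewrite -divgS ?(rotg_G dihG) // oG (card_rotg dihG) //.
  have : (0 < n %/ d)%N by rewrite divn_gt0 // dvdn_leq.
  move: (n %/ d)%N (divnK dn) => m <- m0.
  by rewrite -muln2 -mulnA mulKn // muln2.
have u_sign : sign_on_multiples d u.
  split=> [k kn|k i kn].
    rewrite markE ?(rotg_G dihG) // !mark_coset_dihg ?(rotg_G dihG) //.
    under eq_bigr do rewrite rotgS_dihg //.
    under [X in _ + Posz X]eq_bigr do rewrite rotgS_dihg //.
    rewrite mark_coset_normal ?(rotg_G dihG) ?(rotg_norm dihG) // index_d.
    rewrite !sum_nat_const card_ord cycle_subG -(rho_nat dihG) (rho_rotg dihG) //.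
    rewrite -[(d %| k%:Z)%Z]/(d %| k)%N.
    by case: (d %| k)%N => /=; lia.
  rewrite markE ?(dihg_G dihG) // !mark_coset_dihg ?(dihg_G dihG) //.
  rewrite mark_coset_normal ?(rotg_G dihG) ?(dihg_G dihG) ?(rotg_norm dihG) //.
  have -> : (dihg k i \subset rotg d) = false.
    apply: contraFF (srho_rotg dihG d i) => /subsetP; apply.
    by rewrite (srho_dihg dihG) // subrr.
  rewrite mul0n subr0 -PoszD.
  under eq_bigr do rewrite dihgS //.
  under [X in (_ + X)%N]eq_bigr do rewrite dihgS //.
  case: (d %| k)%N => /=; last by rewrite !big1.
  suff -> : (\sum_(a < d) (d %| (i - (0 + a%:Z *+ 2))%R)%Z +
             \sum_(a < d) (d %| (i - (1 + a%:Z *+ 2))%R)%Z = 2)%N by [].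
  (* The numbers $2a$ and $2a+1$ with $a<d$ run through $0,\dots,2d-1$, so they meet the class of
     $i$ modulo $d$ twice and the mark is $1-2$. *)
  have two : (\sum_(t < d.*2) (d %| (i - t%:Z)%R)%Z = 2)%N.
    rewrite -addnn big_split_ord /= count_residue //.
    congr (1 + _)%N; rewrite -[RHS](count_residue (i - d%:Z) d0).
    by apply: eq_bigr => t _; congr nat_of_bool; congr (_ %| _)%Z; lia.
  rewrite -[RHS]two -(sum_even_odd (fun t => (d %| i - t%:Z)%Z : nat)).
  by congr (_ + _)%N; apply: eq_bigr => a _; congr nat_of_bool;
    congr (_ %| _)%Z; lia.
exists u => //; apply/unitrP; exists u; suff uu : u * u = 1 by [].
apply: (burnside_dih_inj dihG) => [k kn|k i kn].
  by rewrite markM ?mark1 ?(rotg_G dihG) // u_sign.1.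
by rewrite markM ?mark1 ?(dihg_G dihG) // u_sign.2 // -expr2 sqrr_sign.
Qed.

(* The product of the marks at the <r^k, s>, k in S, is a character of the unit
   group that is trivial on the image but not on the unit attached to d. *)
Lemma not_surjective (S : seq nat) d :
    all (fun k => k %| n)%N S -> (d %| n)%N ->
    odd (count (fun k => d %| k)%N S) ->
    (forall e, (e %| n)%N -> ~~ odd (\sum_(k <- S) gcdn k e)%N) ->
    (forall e c, (e %| n)%N -> ~~ odd (\sum_(k <- S) refl_dcosets c (gcdn k e))%N) ->
  ~ (forall u, u \is a GRing.unit -> in_image u).
Proof.
move=> /allP S_n dn odd_S even_rot even_dih surj.
pose phi u : int := \prod_(k <- S) mark (dihg k 0) u.
have phiM : {morph phi : u v / u * v}.
  move=> u v; rewrite /phi -big_split /=; apply: eq_bigr => k _.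
  by rewrite markM // (dihg_G dihG).
have signs (F : nat -> nat) : \prod_(k <- S) (-1) ^+ F k = (-1) ^+ odd (\sum_(k <- S) F k)%N :> int.
  by rewrite signr_odd (big_morph _ (exprD _) (expr0 _)).
have phi_ten (H : {group gT}) : H \subset G -> phi (ten H) = 1.
  case/(subgroup_dih dihG)=> e [en [->|[i ->]]].
    rewrite /phi (eq_big_seq (fun k => (-1) ^+ gcdn k e)) => [|k /S_n kn].
      by rewrite signs (negbTE (even_rot e en)).
    by rewrite (mark_ten_dr dihG).
  rewrite /phi (eq_big_seq (fun k => (-1) ^+ refl_dcosets (i - 0) (gcdn k e))) => [|k /S_n kn].
    by rewrite (signs (fun k => _)) (negbTE (even_dih e _ en)).
  by rewrite (mark_ten_dd dihG).
have phi1 : phi 1 = 1 by rewrite /phi big1 // => k _; rewrite mark1 ?(dihg_G dihG).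
have phi_act (T : finType) (to : action G T) : phi (exp_action to) = 1.
  rewrite /exp_action (big_morph phi phiM phi1) big1 // => x _.
  by apply: phi_ten; apply: subsetIl.
have [u Uu [_ dih_u]] := sign_on_multiples_exists dn.
have [a uE] := surj u Uu.
(* A value of [exp_map] is a quotient of two products of tensor inductions; clearing the denominator
   forces [phi u = 1], whereas its sign is $-1$ by the choice of $d$. *)
have : phi u * phi (exp_action (gclass_act (generic_quotient.repr a).2)) =
       phi (exp_action (gclass_act (generic_quotient.repr a).1)).
  by rewrite -phiM -uE /exp_map divrK // exp_action_unit.
rewrite !phi_act mulr1 /phi (eq_big_seq (fun k => (-1) ^+ (d %| k)%N)) => [|k /S_n kn].
  rewrite (signs (fun k => (d %| k)%N : nat)).
  suff -> : (\sum_(k <- S) (d %| k) = count (fun k => d %| k) S)%N by rewrite odd_S.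
  rewrite -sum1_count [RHS]big_mkcond.
  by apply: eq_bigr => k _; case: (d %| k)%N.
by rewrite dih_u.
Qed.

End SignUnits.

(** * Dihedral generators and gcds with small moduli *)

Lemma dihedral_generators n : (1 < n)%N ->
  exists r s : gsort 'D_(n.*2), dihedral_pair ('D_(n.*2))%G n r s.
Proof.
move=> n_gt1; have := Grp_dihedral n_gt1; have := card_dihedral n_gt1.
set G := ('D_(n.*2))%G => oG isoG.
have [_ /existsP[[x y] /= /eqP[defG xn y2 xy]]] := isoGrpP _ isoG (isog_refl G).
have{} defG : (<[x]> * <[y]> = G)%g.
  by rewrite -norm_joinEr // norms_cycle xy groupV cycle_id.
have ltnG : (n < #|G|)%N by rewrite oG; lia.
(* Otherwise $G=\langle x\rangle$ would have order at most $n$. *)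
have notXy : y \notin <[x]>%g.
  apply: contraL ltnG => Xy; rewrite -leqNgt -defG mulGSid ?cycle_subG //.
  by rewrite dvdn_leq ?(ltnW n_gt1) // order_dvdn xn.
have oy : #[y]%g = 2%N by apply: nt_prime_order (group1_contra notXy).
have ox : #[x]%g = n.
  apply: double_inj; rewrite -muln2 -oy -[in RHS]oG -defG TI_cardMg //.
  by rewrite setIC prime_TIg ?cycle_subG // -orderE oy.
exists x, y; split; first by split; rewrite ?inE // -expg2 // ; exact: y2.
by rewrite ox oG (ltnW n_gt1).
Qed.

Lemma gcdn_prime p e : prime p -> gcdn p e = 1%N \/ gcdn p e = p.
Proof.
move=> p_pr; have [pe|npe] := boolP (p %| e)%N; first by right; apply/gcdn_idPl.
by left; apply/eqP; rewrite -/(coprime p e) prime_coprime.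
Qed.

Lemma gcdn_primeM p q e : prime p -> coprime p q ->
  gcdn (p * q) e = (gcdn p e * gcdn q e)%N.
Proof.
move=> p_pr co_pq; have [/dvdnP[f ->]|npe] := boolP (p %| e)%N.
  rewrite [(f * p)%N]mulnC -muln_gcdr gcdnMr; congr (_ * _)%N.
  by rewrite Gauss_gcdr // coprime_sym.
have /eqP -> : coprime p e by rewrite prime_coprime.
by rewrite mul1n gcdnC Gauss_gcdr 1?gcdnC // coprime_sym prime_coprime.
Qed.

Lemma gcdn_2_4 e : [\/ gcdn 2 e = 1%N /\ gcdn 4 e = 1%N,
  gcdn 2 e = 2 /\ gcdn 4 e = 2 | gcdn 2 e = 2 /\ gcdn 4 e = 4]%N.
Proof.
rewrite ![gcdn _ e]gcdnC -(gcdn_modl e 4) -(gcdn_modl e 2) -(@modn_dvdm 4 e 2) //.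
have : (e %% 4 < 4)%N by rewrite ltn_mod.
by case: (e %% 4)%N => [|[|[|[|]]]] // _; [constructor 3|constructor 1|constructor 2|constructor 1].
Qed.

Lemma gcdn_4_8 e : gcdn 8 e = gcdn 4 e \/ gcdn 4 e = 4%N /\ gcdn 8 e = 8%N.
Proof.
rewrite ![gcdn _ e]gcdnC -(gcdn_modl e 8) -(gcdn_modl e 4) -(@modn_dvdm 8 e 4) //.
have : (e %% 8 < 8)%N by rewrite ltn_mod.
by case: (e %% 8)%N => [|[|[|[|[|[|[|[|]]]]]]]] // _; [right|left|left|left|left|left|left|left].
Qed.

(** * Units in the image and obstructions *)

Section Surjectivity.

Variables (gT : finGroupType) (G : {group gT}) (n : nat) (r s : gT).
Hypothesis dihG : dihedral_pair G n r s.

Lemma sign_in_image_prime_power d : (d %| n)%N ->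
    [\/ d = 1%N, d = 2%N, d = 4%N |
     exists p j, [/\ prime p, p = 3 %[mod 4] & d = (p ^ j.+1)%N \/ d = (p ^ j.+1).*2]] ->
  exists2 v : burnside G, in_image v & sign_on_multiples n r s d v.
Proof.
have rot k := in_image_ten (rotg_G dihG k).
have dih k := in_image_ten (dihg_G dihG k 0).
move=> dn [dE|dE|dE|[p [j [p_pr p3 [dE|dE]]]]]; move: dn; rewrite {}dE => dn.
- by exists (tensor_induction G (-1 : burnside (rotg r 1))); last exact: sign_on_multiples1.
- by eexists; last exact: sign_on_multiples2; apply: in_imageM.
(* Here $4=p^{j+1}$ with $p=2$ and $j=1$. *)
- by eexists; last apply: (@sign_on_multiples_pfactor _ _ _ _ _ dihG 2 1) => //;
    [apply: in_imageM | left].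
- by eexists; last apply: (sign_on_multiples_pfactor dihG p_pr (or_intror p3)) => //;
    apply: in_imageM.
by eexists; last apply: (sign_on_multiples_double_pfactor dihG p_pr p3) => //;
  do !apply: in_imageM.
Qed.

(** The double coset numbers are $1$ and either $1$ or $(p+1)/2$, which is odd. *)
Lemma not_surjective_1mod4 p : prime p -> p = 1 %[mod 4] -> (p %| n)%N ->
  ~ (forall u : burnside G, u \is a GRing.unit -> in_image u).
Proof.
move=> p_pr p1 pn; apply: (not_surjective dihG (S := [:: 1%N; p]) _ pn).
- by rewrite /= pn dvd1n.
- by rewrite /= dvdnn dvdn1; case: eqP p_pr => [->|].
- by move=> e en; rewrite !big_cons big_nil gcd1n; have [->|->] := gcdn_prime e p_pr; lia.
move=> e c en; rewrite !big_cons big_nil gcd1n /refl_dcosets.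
by case: ifP => _; have [->|->] := gcdn_prime e p_pr; lia.
Qed.

(** With $a$, $b$ the odd gcds of $p$, $q$ with $e$, the gcds sum to $(1+a)(1+b)$ and the double
    coset numbers to $(1+a)(1+b)/2+2$, both even. *)
Lemma not_surjective_odd_primes p q : prime p -> prime q -> odd p -> odd q ->
    p != q -> (p * q %| n)%N ->
  ~ (forall u : burnside G, u \is a GRing.unit -> in_image u).
Proof.
move=> p_pr q_pr odd_p odd_q p_q pqn.
have co_pq : coprime p q by rewrite prime_coprime // dvdn_prime2.
have p1 := prime_gt1 p_pr; have q1 := prime_gt1 q_pr.
have [pn qn] : (p %| n)%N /\ (q %| n)%N.
  by split; apply: dvdn_trans pqn; [apply: dvdn_mulr | apply: dvdn_mull].
have odd_gcd m e : odd m -> exists x, gcdn m e = x.*2.+1.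
  by move=> odd_m; exists (gcdn m e)./2; have := dvdn_odd (dvdn_gcdl m e) odd_m; lia.
apply: (not_surjective dihG (S := [:: 1%N; p; q; (p * q)%N]) _ pqn).
- by rewrite /= pn qn pqn dvd1n.
- have p_lt : (p < p * q)%N by rewrite ltn_Pmulr // ltnW.
  have q_lt : (q < p * q)%N by rewrite ltn_Pmull // ltnW.
  by rewrite /= dvdnn !gtnNdvd //; lia.
- move=> e en; rewrite !big_cons big_nil gcd1n gcdn_primeM //.
  have [x ->] := odd_gcd p e odd_p; have [y ->] := odd_gcd q e odd_q.
  by rewrite !(oddD, oddM) /= !odd_double.
move=> e c en; rewrite !big_cons big_nil gcd1n gcdn_primeM // /refl_dcosets.
have [x ->] := odd_gcd p e odd_p; have [y ->] := odd_gcd q e odd_q.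
have -> : (x.*2.+1 * y.*2.+1 = 4 * (x * y) + x.*2 + y.*2 + 1)%N by lia.
by move: (x * y)%N => z; case: ifP => _; lia.
Qed.

(** Let $x$ be the odd gcd of $p$ and $e$. Unless $4\mid e$, the gcds are equal in pairs; otherwise
    they are $2,4,2x,4x$ and the double coset numbers sum to $3(1+x)$ or $3(1+x)+4$. *)
Lemma not_surjective_4p p : prime p -> odd p -> (4 * p %| n)%N ->
  ~ (forall u : burnside G, u \is a GRing.unit -> in_image u).
Proof.
move=> p_pr odd_p pn; have p1 := prime_gt1 p_pr.
have pdv k : (k %| 4 * p)%N -> (k %| n)%N by move=> kp; apply: dvdn_trans pn.
have co_p (b : nat) : coprime p (2 ^ b) by rewrite coprimeXr // coprimen2.
apply: (not_surjective dihG (S := [:: 2; 4; p * 2; 4 * p]%N) _ pn).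
- rewrite /= pn !pdv //; first by rewrite mulnC dvdn_mul.
    by rewrite dvdn_mulr.
  by rewrite dvdn_mulr.
- by rewrite /= dvdnn !gtnNdvd //; lia.
- move=> e en; rewrite !big_cons big_nil [(4 * p)%N]mulnC.
  rewrite (gcdn_primeM e p_pr (co_p 1%N)) (gcdn_primeM e p_pr (co_p 2)).
  by have [[-> ->]|[-> ->]|[-> ->]] := gcdn_2_4 e; lia.
move=> e c en; rewrite !big_cons big_nil [(4 * p)%N]mulnC /refl_dcosets.
rewrite (gcdn_primeM e p_pr (co_p 1%N)) (gcdn_primeM e p_pr (co_p 2)).
have := dvdn_odd (dvdn_gcdl p e) odd_p; move: (gcdn p e) => x odd_x.
by have [[-> ->]|[-> ->]|[-> ->]] := gcdn_2_4 e; case: ifP => _; lia.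
Qed.

(** The two gcds agree unless $8\mid e$; then the double coset numbers are $2,4$ or $3,5$. *)
Lemma not_surjective_8 : (8 %| n)%N ->
  ~ (forall u : burnside G, u \is a GRing.unit -> in_image u).
Proof.
move=> n8; apply: (not_surjective dihG (S := [:: 4; 8]%N) _ n8) => //.
- by rewrite /= n8 (dvdn_trans _ n8).
- move=> e en; rewrite !big_cons big_nil.
  by have [->|[-> ->]] := gcdn_4_8 e; lia.
move=> e c en; rewrite !big_cons big_nil /refl_dcosets.
by have [->|[-> ->]] := gcdn_4_8 e; case: ifP => _; lia.
Qed.

End Surjectivity.

(** * Totients modulo 4 *)

Lemma pow2_or_odd_prime n : (0 < n)%N -> (exists a, n = (2 ^ a)%N) \/
  exists p j m, [/\ prime p, odd p, coprime p m & n = (p ^ j.+1 * m)%N].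
Proof.
move=> n0; have [m co_m nE] := pfactor_coprime (isT : prime 2) n0.
have m0 : (0 < m)%N by rewrite lt0n; apply: contraTneq n0 => m0; rewrite nE m0.
have [m1|m_gt1] := leqP m 1.
  by left; exists (logn 2 n); rewrite [LHS]nE (_ : m = 1%N) ?mul1n //; lia.
right; set p := pdiv m; have p_pr : prime p by apply: pdiv_prime.
have pm : (p %| m)%N := pdiv_dvd m.
have [k co_k mE] := pfactor_coprime p_pr n0.
have odd_p : odd p by rewrite (dvdn_odd pm) // -coprime2n.
have : (0 < logn p n)%N by rewrite logn_gt0 mem_primes p_pr n0 nE dvdn_mulr.
case lE: (logn p n) => [//|j] _; exists p, j, k; split=> //.
by rewrite mulnC -lE.
Qed.

Lemma totient_pfactor_mul p j m : prime p -> coprime p m ->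
  totient (p ^ j.+1 * m) = (p.-1 * p ^ j * totient m)%N.
Proof.
by move=> p_pr co_pm; rewrite totient_coprime ?coprimeXl // totient_pfactor.
Qed.

Lemma odd_totient m : (0 < m)%N -> odd (totient m) -> (m <= 2)%N.
Proof.
move=> m0; have [[[|[|a]] ->]|[p [j [k [p_pr odd_p co_pk ->]]]]] := pow2_or_odd_prime m0 => //.
  by rewrite totient_pfactor // !oddM oddX.
by rewrite totient_pfactor_mul // !oddM; have := prime_gt0 p_pr; lia.
Qed.

(** A power of two must be 4. Otherwise $n=p^{j+1}m$ with $p=2t+1$ and $\phi(n)=2tp^j\phi(m)$, so
    $t$ and $\phi(m)$ are odd: $p\equiv3$ modulo 4 and $m\le2$. *)
Lemma totient_2mod4_divisors n d : (2 < n)%N -> totient n = 2 %[mod 4] -> (d %| n)%N ->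
  [\/ d = 1%N, d = 2%N, d = 4%N |
     exists p j, [/\ prime p, p = 3 %[mod 4] & d = (p ^ j.+1)%N \/ d = (p ^ j.+1).*2]].
Proof.
move=> n_gt2; have n0 : (0 < n)%N by lia.
have [[a nE]|[p [j [m [p_pr odd_p co_pm nE]]]]] := pow2_or_odd_prime n0.
  case: a nE n_gt2 => [|[|[|a]]] -> //= _.
    move=> _ d4; have := dvdn_leq (isT : (0 < 2 ^ 2)%N) d4.
    by case: d d4 => [|[|[|[|[|]]]]] // _ _;
      [constructor 1 | constructor 2 | constructor 3].
  by rewrite totient_pfactor // mul1n !expnS; move: (2 ^ a)%N => b; lia.
rewrite nE totient_pfactor_mul // => phi2.
have odd_pX i : odd (p ^ i) by rewrite oddX odd_p orbT.
have m0 : (0 < m)%N by rewrite lt0n; apply: contraTneq n0 => m0; rewrite nE m0 muln0.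
have [t pE] : exists t, p = (t.*2.+1)%N by exists p./2; lia.
have pred_p : p.-1 = t.*2 by rewrite pE.
have phi_odd : odd (t * p ^ j * totient m).
  by move: phi2; rewrite pred_p -!mul2n -!mulnA; move: (t * _)%N => w; lia.
have m_le2 : (m <= 2)%N.
  by apply: odd_totient => //; move: phi_odd; rewrite !oddM => /andP[].
have p3 : p = 3 %[mod 4] by move: phi_odd; rewrite !oddM pE => /andP[/andP[]]; lia.
have dX e : (e %| p ^ j.+1)%N -> e = 1%N \/ exists i, e = (p ^ i.+1)%N.
  by case/dvdn_pfactor=> // -[|i] _ ->; [left | right; exists i].
case: m m0 m_le2 co_pm {nE phi2 phi_odd} => [|[|[|]]] // _ _ co_pm; rewrite ?muln1.
  by case/dX=> [->|[i ->]]; [constructor | constructor 4; exists p, i; split=> //; left].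
have [/dvdnP[e ->]|nd2] := boolP (2 %| d)%N.
  rewrite dvdn_pmul2r // => /dX[->|[i ->]]; first by constructor 2.
  by constructor 4; exists p, i; split=> //; right; rewrite muln2.
rewrite Gauss_dvdl; last by rewrite coprimen2 -[odd d]negbK -dvdn2.
by case/dX=> [->|[i ->]]; [constructor | constructor 4; exists p, i; split=> //; left].
Qed.

(** For an odd prime $p\not\equiv1$ modulo 4 dividing $n$, the cofactor $m$ has another odd prime
    factor or is $2^b$, where $b\ge2$ gives $4p\mid n$. *)
Lemma totient_not_2mod4 n : (2 < n)%N -> totient n <> 2 %[mod 4] ->
  [\/ exists p, [/\ prime p, p = 1 %[mod 4] & (p %| n)%N],
      exists p q, [/\ prime p, prime q, odd p, odd q & (p != q) && (p * q %| n)%N],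
      exists p, [/\ prime p, odd p & (4 * p %| n)%N] | (8 %| n)%N].
Proof.
move=> n_gt2; have n0 : (0 < n)%N by lia.
have [[a nE]|[p [j [m [p_pr odd_p co_pm nE]]]]] := pow2_or_odd_prime n0.
  case: a nE n_gt2 => [|[|[|a]]] -> //= _ _.
  by constructor 4; rewrite (@dvdn_exp2l 2 3).
rewrite nE totient_pfactor_mul // => phi2.
have m0 : (0 < m)%N by rewrite lt0n; apply: contraTneq n0 => m0; rewrite nE m0 muln0.
have pX : (p %| p ^ j.+1)%N by rewrite expnS dvdn_mulr.
have [p1|p1] := eqVneq (p %% 4)%N 1%N.
  by constructor 1; exists p; split=> //; rewrite dvdn_mulr.
have [[b mE]|[q [i [k [q_pr odd_q co_qk mE]]]]] := pow2_or_odd_prime m0; last first.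
  constructor 2; exists p, q; split=> //.
  have qm : (q %| m)%N by rewrite mE expnS -mulnA dvdn_mulr.
  rewrite dvdn_mul // andbT; apply: contraTneq co_pm => ->.
  by rewrite prime_coprime // qm.
case: b mE => [|[|b]] mE.
(* For $m\le2$, $\phi(n)$ is $4t+2$ times an odd number, hence 2 modulo 4, a contradiction. *)
- case: phi2; rewrite mE muln1.
  have [t ->] : exists t, p = (4 * t + 3)%N by exists (p %/ 4)%N; lia.
  have : odd ((4 * t + 3) ^ j)%N by rewrite oddX; lia.
  have -> : (4 * t + 3).-1 = (4 * t + 2)%N by lia.
  by rewrite mulnDl -mulnA; move: (_ ^ _)%N => w; move: (t * w)%N; lia.
- case: phi2; rewrite mE muln1.
  have [t ->] : exists t, p = (4 * t + 3)%N by exists (p %/ 4)%N; lia.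
  have : odd ((4 * t + 3) ^ j)%N by rewrite oddX; lia.
  have -> : (4 * t + 3).-1 = (4 * t + 2)%N by lia.
  by rewrite mulnDl -mulnA; move: (_ ^ _)%N => w; move: (t * w)%N; lia.
constructor 3; exists p; split=> //.
by rewrite [(4 * p)%N]mulnC dvdn_mul // mE (@dvdn_exp2l 2 2).
Qed.

Theorem corollary8p8 (n : nat) (n_ge3 : (3 <= n)%N) :
  (forall u : burnside ('D_(n.*2))%G,
     u \is a GRing.unit -> exists a : burnside ('D_(n.*2))%G, exp_map a = u)
  <-> (totient n = 2 %[mod 4])%N.
Proof.
have [r [s dihG]] := dihedral_generators (ltnW n_ge3).
split=> [surj|phi2 u Uu].
  apply/eqP; apply: contraPT surj => /eqP /(totient_not_2mod4 n_ge3).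
  case=> [[p [p_pr p1 pn]]|[p [q [p_pr q_pr odd_p odd_q /andP[pq pqn]]]]|[p [p_pr odd_p pn]]|n8].
  - exact: (not_surjective_1mod4 dihG p_pr p1 pn).
  - exact: (not_surjective_odd_primes dihG p_pr q_pr odd_p odd_q pq pqn).
  - exact: (not_surjective_4p dihG p_pr odd_p pn).
  exact: (not_surjective_8 dihG n8).
apply: (in_image_all dihG) Uu => d dn.
by apply: sign_in_image_prime_power => //; apply: totient_2mod4_divisors phi2 dn.
Qed.
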